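(* The following problem is undecidable: given a labeled one-clock priced timed automaton $\mathcal{A}$ with two cost functions, both stopwatch (all location rates in $\{0,1\}$), and a WMTL formula $\varphi$, decide whether there exists a finite run of $\mathcal{A}$ starting in the initial state $(q_0,0)$ that satisfies $\varphi$.
   Context: A priced timed automaton (PTA) is $\mathcal{A}=(Q,q_0,X,E,\mathrm{Inv},(\mathrm{cost}_i)_i)$: finite locations $Q$, initial $q_0$, clocks $X$ (here one clock), transitions $E\subseteq Q\times\mathcal{C}(X)\times2^X\times Q$ with clock constraints $g::=x\sim c\mid g\wedge g$ ($c\in\mathbb{N}$, $\sim\in\{<,\le,=,\ge,>\}$), invariants $\mathrm{Inv}:Q\to\mathcal{C}(X)$, cost functions $\mathrm{cost}_i:Q\cup E\to\mathbb{N}$; labeled by $\ell:Q\to2^{AP}$. A cost is stopwatch if its location rates lie in $\{0,1\}$. Semantics: discrete moves $(q,v)\xrightarrow{e}(q',v')$ for $e=(q,g,R,q')$ with $v\models g$, $v'=v[R\leftarrow0]$, $v'\models\mathrm{Inv}(q')$, costing $\mathrm{cost}_i(e)$; delay moves $(q,v)\xrightarrow{t}(q,v+t)$ if the invariant holds throughout, costing $t\cdot\mathrm{cost}_i(q)$. A mixed move is a delay followed by a discrete move; a finite run $\varrho$ is a sequence of mixed moves with length $|\varrho|$, prefixes $\varrho_{\le\pi}$, suffixes $\varrho_{\ge\pi}$, costs given by sums. WMTL: $\varphi::=a\mid\neg\varphi\mid\varphi\vee\varphi\mid\varphi\mathsf{U}_{\mathrm{cost}\sim c}\varphi$ (with $\mathrm{cost}$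 any of the automaton's cost functions) over finite runs: $\varrho\models a$ iff $a$ labels the first location of $\varrho$; Boolean cases as usual; $\varrho\models\varphi_1\mathsf{U}_{\mathrm{cost}\sim c}\varphi_2$ iff there is $0<\pi\le|\varrho|$ with $\varrho_{\ge\pi}\models\varphi_2$, $\varrho_{\ge\pi'}\models\varphi_1$ for all $0<\pi'<\pi$, and $\mathrm{cost}(\varrho_{\le\pi})\sim c$. *)

(* Defs.v *)
From HB Require Import structures.
From mathcomp Require Import all_boot all_order all_algebra.
From mathcomp Require Import reals.

Set Implicit Arguments.
Unset Strict Implicit.
Unset Printing Implicit Defensive.

Import Order.TTheory GRing.Theory Num.Theory.

Local Open Scope ring_scope.

#[local] Arguments CodeSeq.code : simpl never.

Inductive cmp := Lt | Le | Eq | Ge | Gt.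

Definition holds (R : realType) (o : cmp) (x y : R) : Prop :=
  match o with
  | Lt => x < y
  | Le => x <= y
  | Eq => x = y
  | Ge => x >= y
  | Gt => x > y
  end.

Inductive constr (m : nat) :=
  | CAtom of 'I_m & cmp & nat
  | CAnd of constr m & constr m.

Definition enc_cmp (o : cmp) : nat :=
  match o with Lt => 0 | Le => 1 | Eq => 2 | Ge => 3 | Gt => 4 end%N.

Fixpoint enc_constr m (g : constr m) : nat :=
  match g with
  | CAtom x o c => CodeSeq.code [:: 0; val x; enc_cmp o; c]%N
  | CAnd g1 g2 => CodeSeq.code [:: 1; enc_constr g1; enc_constr g2]%N
  end.

Lemma enc_cmp_inj : injective enc_cmp.
Proof. by case; case. Qed.

Lemma enc_constr_inj m : injective (@enc_constr m).
Proof.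
elim=> [x o c|g1 IH1 g2 IH2] [x' o' c'|h1 h2] /= /(can_inj CodeSeq.codeK) //.
- by case=> /val_inj -> /enc_cmp_inj -> ->.
- by case=> /IH1 -> /IH2 ->.
Qed.

HB.instance Definition _ m :=
  Equality.copy (constr m) (inj_type (@enc_constr_inj m)).

(* (source, guard, reset set, target), with n locations and m clocks *)
Definition edge (n m : nat) : Type :=
  ('I_n * constr m * {set 'I_m} * 'I_n)%type.

Section Edge.
Variables n m : nat.
Implicit Type e : edge n m.
Definition src e : 'I_n := e.1.1.1.
Definition guard e : constr m := e.1.1.2.
Definition reset e : {set 'I_m} := e.1.2.
Definition tgt e : 'I_n := e.2.
End Edge.

(* Labeled priced timed automata with m clocks and k cost functions. The finite
   set E of transitions is the set of elements of [edges]; the cost functions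
   on Q and on E are separate fields, and [ecost] is only ever used on E.
   Atomic propositions are natural numbers. *)
Record pta (m k : nat) := PTA {
  nloc : nat;
  init : 'I_nloc;
  edges : seq (edge nloc m);
  inv : 'I_nloc -> constr m;
  lcost : 'I_k -> 'I_nloc -> nat;
  ecost : 'I_k -> edge nloc m -> nat;
  label : 'I_nloc -> seq nat
}.

Definition stopwatch m k (A : pta m k) (i : 'I_k) : Prop :=
  forall q : 'I_(nloc A), lcost i q = 0%N \/ lcost i q = 1%N.

Inductive wmtl (k : nat) :=
  | WAtom of nat
  | WNot of wmtl k
  | WOr of wmtl k & wmtl k
  | WUntil of wmtl k & 'I_k & cmp & nat & wmtl k.

Section Semantics.
Variables (R : realType) (m k : nat) (A : pta m k).

Definition valuation : Type := {ffun 'I_m -> R}.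

Fixpoint csat (v : valuation) (g : constr m) : Prop :=
  match g with
  | CAtom x o c => holds o (v x) c%:R
  | CAnd g1 g2 => csat v g1 /\ csat v g2
  end.

Definition state : Type := ('I_(nloc A) * valuation)%type.

Definition init_state : state := (init A, [ffun=> 0]).

Definition vdelay (v : valuation) (t : R) : valuation := [ffun x => v x + t].

Definition vreset (v : valuation) (X : {set 'I_m}) : valuation :=
  [ffun x => if x \in X then 0 else v x].

Definition delay_move (s : state) (t : R) (s' : state) : Prop :=
  [/\ 0 <= t,
      forall t', 0 <= t' <= t -> csat (vdelay s.2 t') (inv s.1)
    & s' = (s.1, vdelay s.2 t)].

Definition discrete_move (s : state) (e : edge (nloc A) m) (s' : state) :
    Prop :=
  [/\ e \in edges A, src e = s.1, csat s.2 (guard e),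
      s' = (tgt e, vreset s.2 (reset e))
    & csat s'.2 (inv s'.1)].

Definition mixed_move (s : state) (t : R) (e : edge (nloc A) m) (s' : state) :
    Prop :=
  exists2 s1 : state, delay_move s t s1 & discrete_move s1 e s'.

(* A step (t, e, s') records the delay, the transition and the state reached. *)
Definition step : Type := (R * edge (nloc A) m * state)%type.

Record run := Run { start : state; steps : seq step }.

Fixpoint is_path (s : state) (p : seq step) : Prop :=
  match p with
  | [::] => True
  | (t, e, s') :: p' => mixed_move s t e s' /\ is_path s' p'
  end.

Definition is_run (rho : run) : Prop := is_path (start rho) (steps rho).

Definition run_length (rho : run) : nat := size (steps rho).

Definition prefix_run (rho : run) (n : nat) : run :=
  Run (start rho) (take n (steps rho)).

Definition suffix_run (rho : run) (n : nat) : run :=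
  Run (last (start rho) [seq x.2 | x <- take n (steps rho)])
      (drop n (steps rho)).

Fixpoint path_cost (i : 'I_k) (s : state) (p : seq step) : R :=
  match p with
  | [::] => 0
  | (t, e, s') :: p' =>
      t * (lcost i s.1)%:R + (ecost i e)%:R + path_cost i s' p'
  end.

Definition run_cost (i : 'I_k) (rho : run) : R :=
  path_cost i (start rho) (steps rho).

Fixpoint sat (rho : run) (phi : wmtl k) : Prop :=
  match phi with
  | WAtom a => a \in label (start rho).1
  | WNot phi1 => ~ sat rho phi1
  | WOr phi1 phi2 => sat rho phi1 \/ sat rho phi2
  | WUntil phi1 i o c phi2 =>
      exists n : nat,
        [/\ (0 < n <= run_length rho)%N,
            sat (suffix_run rho n) phi2,
            forall n' : nat, (0 < n' < n)%N -> sat (suffix_run rho n') phi1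
          & holds o (run_cost i (prefix_run rho n)) c%:R]
  end.

End Semantics.

(* Kleene's partial recursive functions, indexed by arity. *)
Inductive recfun : nat -> Type :=
  | RZero k : recfun k
  | RSucc : recfun 1
  | RProj k : 'I_k -> recfun k
  | RComp k l : recfun l -> ('I_l -> recfun k) -> recfun k
  | RPrec k : recfun k -> recfun k.+2 -> recfun k.+1
  | RMin k : recfun k.+1 -> recfun k.

(* [computes f xs y]: f is defined on xs, with value y. In the case of
   primitive recursion, h lists the intermediate values; minimisation requires
   the function to be defined and nonzero at all arguments below the result. *)
Fixpoint computes k (f : recfun k) : k.-tuple nat -> nat -> Prop :=
  match f in recfun k return k.-tuple nat -> nat -> Prop with
  | RZero _ => fun _ y => y = 0%N
  | RSucc => fun xs y => y = (thead xs).+1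
  | RProj _ i => fun xs y => y = tnth xs i
  | RComp _ l f g => fun xs y =>
      exists2 ys : l.-tuple nat,
        forall i, computes (g i) xs (tnth ys i) & computes f ys y
  | RPrec k f g => fun xs y =>
      let zs : k.-tuple nat := [tuple of behead xs] in
      exists h : nat -> nat,
        [/\ computes f zs (h 0%N),
            forall i, (i < thead xs)%N ->
              computes g [tuple of i :: h i :: zs] (h i.+1)
          & y = h (thead xs)]
  | RMin _ f => fun xs y =>
      computes f [tuple of y :: xs] 0%N /\
      forall i, (i < y)%N -> exists z, computes f [tuple of i :: xs] z.+1
  end.

(* The problem P on the instances satisfying D, presented to algorithms
   through their codes, is decidable. Nothing is asked of the algorithm on
   numbers that do not encode an instance. *)
Definition decidable_problem (T : Type) (enc : T -> nat) (D P : T -> Prop) :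
    Prop :=
  exists f : recfun 1, forall x, D x ->
    (P x -> computes f [tuple enc x] 1%N) /\
    (~ P x -> computes f [tuple enc x] 0%N).

(* Instances are given by the tables of their components, coded through the
   bijection CodeSeq.code between seq nat and nat. *)

Definition enc_table (n : nat) (f : 'I_n -> nat) : nat :=
  CodeSeq.code [seq f i | i <- enum 'I_n].

Definition enc_edge n m (e : edge n m) : nat :=
  CodeSeq.code [:: val (src e); enc_constr (guard e);
                   enc_table (fun x => x \in reset e : nat); val (tgt e)].

Definition enc_pta m k (A : pta m k) : nat :=
  CodeSeq.code
    [:: nloc A;
        val (init A);
        CodeSeq.code
          [seq CodeSeq.code [:: enc_edge e; enc_table (fun i => ecost i e)]
             | e <- edges A];
        enc_table (fun q => enc_constr (@inv _ _ A q));
        enc_table (fun i => enc_table (fun q => @lcost _ _ A i q));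
        enc_table (fun q => CodeSeq.code (@label _ _ A q))].

Fixpoint enc_wmtl k (phi : wmtl k) : nat :=
  match phi with
  | WAtom a => CodeSeq.code [:: 0; a]%N
  | WNot phi1 => CodeSeq.code [:: 1; enc_wmtl phi1]%N
  | WOr phi1 phi2 => CodeSeq.code [:: 2; enc_wmtl phi1; enc_wmtl phi2]%N
  | WUntil phi1 i o c phi2 =>
      CodeSeq.code
        [:: 3; enc_wmtl phi1; val i; enc_cmp o; c; enc_wmtl phi2]%N
  end.

Lemma enc_wmtl_inj k : injective (@enc_wmtl k).
Proof.
elim=> [a|f IH|f1 IH1 f2 IH2|f1 IH1 i o c f2 IH2]
  [a'|g|g1 g2|g1 i' o' c' g2] /= /(can_inj CodeSeq.codeK) //.
- by case=> ->.
- by case=> /IH ->.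
- by case=> /IH1 -> /IH2 ->.
- by case=> /IH1 -> /val_inj -> /enc_cmp_inj -> -> /IH2 ->.
Qed.

Definition enc_instance m k (I : pta m k * wmtl k) : nat :=
  CodeSeq.code [:: enc_pta I.1; enc_wmtl I.2].

(* Main.v *)
From HB Require Import structures.
Require Import Defs.
From mathcomp Require Import all_boot all_order all_algebra.
From mathcomp Require Import boolp reals zify lra.

Set Implicit Arguments.
Unset Strict Implicit.
Unset Printing Implicit Defensive.

Import Order.TTheory GRing.Theory Num.Theory.

(* Partial recursive functions are compiled to nondeterministic programs over
   counters, which are simulated by runs as follows. Time is cut into slots of
   length 1, at the end of which the clock is reset, and each slot contains one
   event; the value held by a slot is the value of the clock at its event. A
   cycle of K slots simulates one instruction: slot 0 holds a small d > 0,
   guessed once and for all, and slot r + 1 holds d times register r. The first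
   cost is time, so that "K + r - s time units after the event of slot s comes
   an event of slot r" says that slot r of the next cycle is a copy of slot s.
   The second cost is time too, except that it is stopped before the event of
   slot 0, hence for d time units in each cycle; so the same formula with the
   second cost says that slot r of the next cycle is slot s plus d. Register 1
   counts the cycles spent in a loading phase, whose length in time is K n for
   an n written in the formula.

   No universal machine is needed: n is taken to be the code of the automaton,
   of the part of the formula that does not depend on n, and of K. If f decides
   the problem, then some program decodes n, computes from it the code of the
   instance that simulates this very program on this very n, and halts iff f
   answers 0 on that instance; the instance then has a run iff f says no. *)

(** * Representable functions *)

Lemma computes_fun k (f : recfun k) xs y z :
  computes f xs y -> computes f xs z -> y = z.
Proof.
elim: f xs y z => {k} [k|| k i|k l f IHf g IHg|k f IHf g IHg|k f IHf] xs y z /=;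
  try by move=> -> ->.
- move=> [ys Hys Hy] [zs Hzs Hz].
  suff E : ys = zs by rewrite -E in Hz; exact: IHf Hy Hz.
  by apply: eq_from_tnth => i; exact: IHg (Hys i) (Hzs i).
- move=> [h [h0 hS ->]] [h' [h'0 h'S ->]].
  suff: forall i, i <= thead xs -> h i = h' i by apply.
  elim=> [|i IHi] lti; first exact: IHf h0 h'0.
  have := h'S _ lti; rewrite -(IHi (ltnW lti)).
  by apply: IHg; exact: hS.
(* At the smaller of [y] and [z], one derivation gives the value 0 and the other a positive
   value. *)
- move=> [y0 yS] [z0 zS]; case: (ltngtP y z) => // lt.
    by have [w Hw] := zS _ lt; have := IHf _ _ _ Hw y0.
  by have [w Hw] := yS _ lt; have := IHf _ _ _ Hw z0.
Qed.

Definition representable k (h : k.-tuple nat -> nat) :=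
  exists f : recfun k, forall xs, computes f xs (h xs).

Definition representable2 (h : nat -> nat -> nat) :=
  representable (fun xs : 2.-tuple nat => h (tnth xs ord0) (tnth xs ord_max)).

Lemma representable_comp k l (h : l.-tuple nat -> nat)
    (g : 'I_l -> k.-tuple nat -> nat) :
  representable h -> (forall i, representable (g i)) ->
  representable (fun xs => h [tuple g i xs | i < l]).
Proof.
move=> [f Hf] /fin_all_exists[G HG]; exists (RComp f G) => xs /=.
by exists [tuple g i xs | i < l] => // i; rewrite tnth_mktuple.
Qed.

Lemma representable_proj k (i : 'I_k) : representable (fun xs => tnth xs i).
Proof. by exists (RProj i). Qed.

Lemma representable_succ k (a : k.-tuple nat -> nat) :
  representable a -> representable (fun xs => (a xs).+1).
Proof.
move=> Ha; have := @representable_comp k 1 (fun xs => (thead xs).+1)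
  (fun _ => a); case => // [|f Hf]; first by exists RSucc.
by exists f => xs; have := Hf xs; rewrite [thead _]tnth_mktuple.
Qed.

Lemma representable_const k n : representable (fun _ : k.-tuple nat => n).
Proof.
elim: n => [|n IHn]; first by exists (RZero k).
exact: representable_succ IHn.
Qed.

Lemma representable_comp2 k h (a b : k.-tuple nat -> nat) :
  representable2 h -> representable a -> representable b ->
  representable (fun xs => h (a xs) (b xs)).
Proof.
move=> Hh Ha Hb.
have := @representable_comp k 2 _ (fun i => if i == ord0 then a else b) Hh.
case=> [i|f Hf]; first by case: ifP.
by exists f => xs; have := Hf xs; rewrite !tnth_mktuple.
Qed.

Lemma representable_prec (h : nat -> nat -> nat) (a : nat -> nat)
    (g : 3.-tuple nat -> nat) :
  representable (fun xs : 1.-tuple nat => a (thead xs)) -> representable g ->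
  (forall b, h 0 b = a b) ->
  (forall n b, h n.+1 b = g [tuple n; h n b; b]) ->
  representable2 h.
Proof.
move=> [F HF] [G HG] h0 hS; exists (RPrec F G) => xs /=.
have Ebs : behead xs = [:: tnth xs ord_max] by case: xs => [[|x [|y []]]].
have Ezs : [tuple of behead xs] = [tuple tnth xs ord_max] by exact: val_inj.
exists (h ^~ (tnth xs ord_max)); split.
- by rewrite h0 Ezs; exact: HF [tuple _].
- move=> i _; rewrite hS.
  set t := (X in computes G X).
  suff -> : t = [tuple i; h i (tnth xs ord_max); tnth xs ord_max] by exact: HG.
  by apply: val_inj; rewrite /= Ebs.
- by [].
Qed.

Lemma representable_add : representable2 addn.
Proof.
apply: (@representable_prec addn id (fun xs => (tnth xs (inord 1)).+1)) => //.
- exact: representable_proj.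
- exact/representable_succ/representable_proj.
- by move=> n b; rewrite (tnth_nth 0) inordK.
Qed.

Lemma representable_mul : representable2 muln.
Proof.
apply: (@representable_prec muln (fun=> 0)
  (fun xs => (tnth xs (inord 2) + tnth xs (inord 1)))) => //.
- exact: representable_const.
- apply: representable_comp2; [exact: representable_add|..];
    exact: representable_proj.
- by move=> n b; rewrite !(tnth_nth 0) !inordK.
Qed.

(** The pairing that [CodeSeq.code] iterates along a list. *)
Definition code_cons a b := 2 ^ a * b.*2.+1.

Lemma code_consE a s : CodeSeq.code (a :: s) = code_cons a (CodeSeq.code s).
Proof. by []. Qed.

Lemma representable_code_cons : representable2 code_cons.
Proof.
have addR k a b := @representable_comp2 k addn a b representable_add.
(* Recursion on the first argument: the value at 0 is 2b + 1 and each successor doubles it, so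
   addition suffices. *)
apply: (@representable_prec code_cons (fun b => (b + b).+1)
  (fun xs => (tnth xs (inord 1) + tnth xs (inord 1)))).
- by apply: representable_succ; apply: addR; exact: representable_proj.
- by apply: addR; exact: representable_proj.
- by move=> b; rewrite /code_cons mul1n addnn.
- by move=> n b; rewrite !(tnth_nth 0) !inordK //= /code_cons expnS -mulnA
    mul2n addnn.
Qed.

(** The length of the list is fixed and only its entries depend on the arguments, so finitely many
    uses of [code_cons] do. *)
Lemma representable_code k (s : seq (k.-tuple nat -> nat)) :
  foldr (fun a P => representable a /\ P) True s ->
  representable (fun xs => CodeSeq.code [seq a xs | a <- s]).
Proof.
elim: s => [_|a s IHs /= [Ha /IHs Hs]]; first exact: representable_const.
exact: (representable_comp2 representable_code_cons Ha Hs).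
Qed.

(** * Counter programs *)

Definition store := nat -> nat.

(* [(test, r, u, i)] is the test [r = u + i] or the assignment [r := u + i]. *)
Definition instr : Type := (bool * nat * nat * bool)%type.

Definition enabled (a : instr) (s : store) : bool :=
  let: (t, r, u, i) := a in t ==> (s r == s u + i).

Definition effect (a : instr) (s : store) : store :=
  let: (t, r, u, i) := a in
  fun q => if ~~ t && (q == r) then s u + i else s q.

Inductive prog :=
  | PInstr of instr
  | PSeq of prog & prog
  | PStar of prog.

Fixpoint iter_rel (T : Type) (n : nat) (S : T -> T -> Prop) (s s' : T) : Prop :=
  if n is n'.+1 then exists2 s1, S s s1 & iter_rel n' S s1 s' else s' = s.

Lemma iter_rel_inv T (S : T -> T -> Prop) (I : nat -> T -> Prop) n s s' i :
  (forall i s s', I i s -> S s s' -> I i.+1 s') ->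
  I i s -> iter_rel n S s s' -> I (i + n) s'.
Proof.
move=> IS; elim: n i s => [|n IHn] i s Is /=; first by move->; rewrite addn0.
by case=> s1 Ss1; rewrite addnS -addSn; apply: IHn; exact: IS Ss1.
Qed.

Fixpoint exec (P : prog) (s s' : store) : Prop :=
  match P with
  | PInstr a => enabled a s /\ s' = effect a s
  | PSeq P1 P2 => exists2 s1, exec P1 s s1 & exec P2 s1 s'
  | PStar P1 => exists n, iter_rel n (exec P1) s s'
  end.

Definition assign r u i := PInstr (false, r, u, i).
Definition test r u := PInstr (true, r, u, false).
Definition skip := test 0 0.
Definition incr r := assign r r true.

(** Frame condition of compiled code, which writes only to registers from [b] on. *)
Definition agree b (s s' : store) := forall r, r < b -> s' r = s r.

Lemma agree_refl b s : agree b s s.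
Proof. by []. Qed.

Lemma agree_trans b s1 s2 s3 : agree b s1 s2 -> agree b s2 s3 -> agree b s1 s3.
Proof. by move=> H12 H23 r ltr; rewrite H23 ?H12. Qed.

Lemma agree_leq b c s1 s2 : b <= c -> agree c s1 s2 -> agree b s1 s2.
Proof. by move=> le H r ltr; rewrite H // (leq_trans ltr). Qed.

Lemma agree_effect b r u i s : b <= r -> agree b s (effect (false, r, u, i) s).
Proof. by move=> le q ltq /=; rewrite ltn_eqF // (leq_trans ltq). Qed.

Lemma agree_set b r v s :
  b <= r -> agree b s (fun q => if q == r then v else s q).
Proof. by move=> le q ltq /=; rewrite ltn_eqF // (leq_trans ltq). Qed.

Lemma agree_map b s s' ins : agree b s s' -> all (ltn^~ b) ins ->
  map s' ins = map s ins.
Proof. by move=> H /allP Hi; apply/eq_in_map => r /Hi /H. Qed.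

Lemma exec_assign r u i s s' :
  exec (assign r u i) s s' <-> s' = effect (false, r, u, i) s.
Proof. by split => [[]|]. Qed.

Lemma exec_test r u s s' : exec (test r u) s s' <-> s r = s u /\ s' = s.
Proof. by rewrite /= addn0; split=> [[/eqP]|[/eqP]]. Qed.

(** This is how a program guesses a number: the star may make any number of rounds. *)
Lemma exec_incr_star r s s' :
  exec (PStar (incr r)) s s' <->
  exists n, s' = fun q => if q == r then s r + n else s q.
Proof.
split=> -[n]; last first.
  move=> ->; exists n; elim: n s => [|n IHn] s /=.
    by apply/funext => q; case: eqP => // ->; rewrite addn0.
  exists (effect (false, r, r, true) s) => //.
  have := IHn (effect (false, r, r, true) s).
  congr (iter_rel _ _ _ _); apply/funext => q /=.
  by case: eqP => //; rewrite eqxx addn1 addSnnS.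
move=> H; exists n; rewrite -[n]add0n.
apply: (iter_rel_inv
  (I := fun n s' => s' = fun q => if q == r then s r + n else s q)) H => /=.
- move=> i _ s2 -> [_ ->]; apply/funext => q /=.
  by rewrite eqxx; case: eqP => // _; rewrite addn1 addnS.
- by apply/funext => q; case: eqP => // ->; rewrite addn0.
Qed.

(* For [c] above the registers in use: a counter at [c] started from 1 can
   reach the value of [r] iff the latter is positive. *)
Definition positive r c :=
  PSeq (assign c 0 true) (PSeq (PStar (incr c)) (test c r)).

Lemma exec_positive r c s s' : s 0 = 0 -> r < c ->
  exec (positive r c) s s' -> 0 < s r /\ agree c s s'.
Proof.
move=> s0 ltrc [_ /exec_assign-> [s1 /exec_incr_star[n ->]]] /exec_test[].
rewrite eqxx !(ltn_eqF ltrc) /= !eqxx (ltn_eqF ltrc) s0 => <- ->.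
split=> //.
by move=> q ltq /=; rewrite !(ltn_eqF ltq).
Qed.

Lemma positive_exec r c s : s 0 = 0 -> r < c -> 0 < s r ->
  exists s', exec (positive r c) s s'.
Proof.
move=> s0 ltrc sr; exists (fun q => if q == c then s r else s q).
exists (effect (false, c, 0, true) s); first exact/exec_assign.
exists (fun q => if q == c then s r else s q).
  apply/exec_incr_star; exists (s r).-1; apply/funext => q /=.
  by rewrite eqxx s0 add0n add1n prednK //; case: eqP.
by apply/exec_test; rewrite eqxx (ltn_eqF ltrc).
Qed.

(* The result goes to register [b]; the registers above [b] are scratch, and
   register 0 must hold 0. *)
Fixpoint compile k (f : recfun k) (ins : seq nat) (b : nat) : prog :=
  match f with
  | RZero _ => assign b 0 false
  | RSucc => assign b (head 0 ins) true
  | RProj _ i => assign b (nth 0 ins i) false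
  | RComp _ l f g =>
      PSeq (foldr (fun i P => PSeq (compile (g i) ins (b + l))
                     (PSeq (assign (b + i) (b + l) false) P))
             skip (enum 'I_l))
        (PSeq (compile f (iota b l) (b + l)) (assign b (b + l) false))
  | RPrec _ f g =>
      PSeq (compile f (behead ins) b) (PSeq (assign b.+1 0 false)
        (PSeq (PStar (PSeq (compile g [:: b.+1, b & behead ins] b.+2)
                 (PSeq (assign b b.+2 false) (incr b.+1))))
           (test b.+1 (head 0 ins))))
  | RMin _ f =>
      PSeq (assign b 0 false)
        (PSeq (PStar (PSeq (compile f (b :: ins) b.+1)
                 (PSeq (positive b.+1 b.+2) (incr b))))
           (PSeq (compile f (b :: ins) b.+1) (test b.+1 0)))
  end.

(** Programs are nondeterministic, so two halves are needed: whatever a finished execution leaves in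
    register [b] is correct, and every defined value is reached by some execution. The frame
    condition is stated in the first half only; it applies to the execution that the second one
    provides. *)
Definition compile_spec k (f : recfun k) :=
  forall ins b s (xs : k.-tuple nat),
    0 < b -> all (ltn^~ b) ins -> s 0 = 0 -> map s ins = xs ->
  (forall s', exec (compile f ins b) s s' ->
     computes f xs (s' b) /\ agree b s s') /\
  (forall y, computes f xs y ->
     exists2 s', exec (compile f ins b) s s' & s' b = y).

Lemma all_ltn_leq b c ins : b <= c -> all (ltn^~ b) ins -> all (ltn^~ c) ins.
Proof. by move=> le; apply: sub_all => r ltr; exact: leq_trans le. Qed.

Lemma compile_comp k l (f : recfun l) (g : 'I_l -> recfun k) :
  compile_spec f -> (forall i, compile_spec (g i)) ->
  compile_spec (RComp f g).
Proof.
move=> Hf Hg ins b s0 xs b0 insb s00 E0.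
have bl0 : 0 < b + l by rewrite ltn_addr.
have insbl : all (ltn^~ (b + l)) ins.
  by apply: all_ltn_leq insb; rewrite leq_addr.
rewrite /=; set lp := foldr _.
have keep s : agree b s0 s -> s 0 = 0 /\ map s ins = xs.
  by move=> H; rewrite (H 0) // (agree_map H).
(* Induction on the arguments still to be computed. The [else] branch keeps earlier results alive:
   scratch space starts at [b + l], above the registers [b + i] that hold them. *)
have sound is_ s s' : agree b s0 s -> exec (lp skip is_) s s' ->
    agree b s0 s' /\ forall i : 'I_l,
      if i \in is_ then computes (g i) xs (s' (b + i))
      else s' (b + i) = s (b + i).
  elim: is_ s => [|i is_ IHis] s Hs /=; first by case=> _ ->.
  have [s_0 Es] := keep _ Hs.
  case=> s1 /(proj1 (Hg i ins _ s xs bl0 insbl s_0 Es)) [C A] [_] [_ ->].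
  case/IHis.
    apply: agree_trans Hs _; apply: (agree_trans (agree_leq (leq_addr l b) A)).
    by apply: (@agree_effect _ (b + i) (b + l) false); rewrite leq_addr.
  move=> Hs' H; split=> // j; have := H j; rewrite in_cons.
  rewrite eqn_add2l val_eqE; case: (eqVneq j i) => [-> /=|Nji /=].
    by case: ifP => // _ ->; rewrite addn0.
  by case: ifP => // _ ->; rewrite A // ltn_add2l.
have complete (ys : 'I_l -> nat) is_ s : agree b s0 s ->
    (forall i, computes (g i) xs (ys i)) ->
    exists s', exec (lp skip is_) s s'.
  move=> Hs Hys; elim: is_ s Hs => [|i is_ IHis] s Hs /=.
    by exists s; rewrite addn0 eqxx.
  have [s_0 Es] := keep _ Hs.
  have [S Cp] := Hg i ins _ s xs bl0 insbl s_0 Es.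
  have [s1 E1 _] := Cp _ (Hys i).
  have [_ A] := S _ E1.
  have [|s' Hs'] := IHis (effect (false, b + i, b + l, false) s1).
    apply: agree_trans Hs _; apply: (agree_trans (agree_leq (leq_addr l b) A)).
    by apply: (@agree_effect _ (b + i) (b + l) false); rewrite leq_addr.
  exists s'; exists s1 => //.
  by exists (effect (false, b + i, b + l, false) s1).
have iotab : all (ltn^~ (b + l)) (iota b l).
  by apply/allP => r; rewrite mem_iota => /andP[].
have Eiota (s : store) : map s (iota b l) = [tuple s (b + i) | i < l].
  rewrite /= -[b in LHS]addn0 iotaDl -map_comp -val_enum_ord -map_comp.
  exact: eq_map.
split=> [s'|y].
- case=> s1 /(sound _ _ _ (@agree_refl _ _))[A1 H1] [s2 E2 [_ ->]].
  have [s1_0 Es1] := keep _ A1.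
  have [+ _] := Hf _ _ _ _ bl0 iotab s1_0 (Eiota s1).
  case/(_ _ E2) => C A2; split.
    exists [tuple s1 (b + i) | i < l]; last by rewrite /= eqxx addn0.
    by move=> i; have := H1 i; rewrite mem_enum tnth_mktuple.
  apply: agree_trans A1 _; apply: (agree_trans (agree_leq (leq_addr l b) A2)).
  exact: agree_set.
- case=> ys Hys Cy.
  have [s1 E1] := complete _ (enum 'I_l) _ (@agree_refl _ _) Hys.
  have [A1 H1] := sound _ _ _ (@agree_refl _ _) E1.
  have [s1_0 Es1] := keep _ A1.
  have [_ +] := Hf _ _ _ _ bl0 iotab s1_0 (Eiota s1).
  have -> : [tuple s1 (b + i) | i < l] = ys.
    apply: eq_from_tnth => i; rewrite tnth_mktuple.
    by have := H1 i; rewrite mem_enum => /computes_fun; apply.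
  case/(_ _ Cy) => s2 E2 <-.
  exists (effect (false, b, b + l, false) s2); last by rewrite /= eqxx addn0.
  by exists s1 => //; exists s2.
Qed.

Lemma compile_prec k (f : recfun k) (g : recfun k.+2) :
  compile_spec f -> compile_spec g -> compile_spec (RPrec f g).
Proof.
move=> Hf Hg ins b s0 xs b0 insb s00 E0.
have [x [zs [Eins Ex Ezs xb zsb]]] : exists x zs, [/\ ins = x :: zs,
    s0 x = thead xs, map s0 zs = behead xs, x < b & all (ltn^~ b) zs].
  case: ins E0 insb => [|x zs] /=; first by case: xs => [[]].
  move=> E /andP[xb zsb]; exists x, zs; split=> //.
    by rewrite /thead (tnth_nth 0) -E.
  by rewrite -E.
set zt : k.-tuple nat := [tuple of behead xs].
have keep s : agree b s0 s -> s 0 = 0 /\ map s zs = zt.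
  by move=> H; rewrite (H 0) // (agree_map H).
rewrite Eins /=.
set body := fun s s' : store => _.
have gspec s i h : agree b s0 s -> s b = h -> s b.+1 = i ->
    (forall s', body s s' -> [/\ agree b s0 s', s' b.+1 = i.+1 &
        computes g [tuple of [:: i, h & zt]] (s' b)]) /\
    (forall y, computes g [tuple of [:: i, h & zt]] y ->
        exists2 s', body s s' & s' b = y).
  move=> Hs Eh Ei; have [s_0 Es] := keep _ Hs.
  have [] := Hg [:: b.+1, b & zs] b.+2 s [tuple of [:: i, h & zt]] => //.
  - by rewrite /= ltnSn ltnW //= (all_ltn_leq _ zsb) // ltnW.
  - by rewrite /= Es Ei Eh.
  move=> S C; have neb : (b == b.+1) = false by rewrite ltn_eqF.
  split=> [s' [s1 /S[C1 A1]] [_ [_ ->]] [_ ->]|y /C[s1 E1 Ey]].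
    split=> /=.
    + apply: agree_trans Hs _; apply: (agree_trans (agree_leq _ A1)).
        by rewrite ltnW.
      by move=> r ltr /=; rewrite ?(ltn_eqF ltr) // ltn_eqF // ltnW.
    + by rewrite eqxx (gtn_eqF (ltnSn b)) A1 // Ei addn1.
    + by rewrite neb eqxx addn0.
  eexists; first by exists s1 => //; eexists; [split; reflexivity|
    split; reflexivity].
  by rewrite /= neb eqxx addn0.
have fspec := Hf zs b s0 zt b0 zsb s00 Ezs.
split=> [s' [s1 /(proj1 fspec)[Cf A1]] [_ [_ ->]] [s3 [n Hn]]|y].
(* The star may stop after any number of rounds. The invariant carries a table [h] of the values of
   the recursion met so far; the final test forces the number of rounds to be the first argument. *)
- have [] := iter_rel_inv (I := fun i s => [/\ agree b s0 s, s b.+1 = i &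
    exists h : nat -> nat, [/\ computes f zt (h 0),
      forall j, j < i -> computes g [tuple of [:: j, h j & zt]] (h j.+1) &
      s b = h i]]) (i := 0) _ _ Hn.
  + move=> i s s2 [As Ei [h [h0 hS Eb]]] /(proj1 (gspec _ _ _ As Eb Ei)).
    move=> [A2 E2 C2]; split=> //.
    exists (fun j => if j == i.+1 then s2 b else h j); split=> //.
      move=> j; rewrite ltnS leq_eqVlt eqSS => /orP[/eqP ->|ltj].
        by rewrite eqxx ltn_eqF.
      rewrite /= (ltn_eqF ltj) (ltn_eqF (ltnW (ltj : j.+1 < i.+1))).
      exact: hS.
    by rewrite eqxx.
  + split=> /=.
    * apply: (agree_trans A1); exact: agree_set.
    * apply: etrans (_ : s1 0 = 0); last by rewrite A1.
      by rewrite eqxx addn0.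
    * by exists (fun=> s1 b); split=> //; rewrite ltn_eqF.
  + rewrite add0n => A3 E3 [h [h0 hS E3b]] [/eqP + ->].
    rewrite addn0 E3 A3 // Ex => En; split=> //.
    by exists h; rewrite -En.
- case=> h [h0 hS ->].
  have [s1 E1 Eb1] := (proj2 fspec) _ h0.
  have [_ A1] := (proj1 fspec) _ E1.
  pose s2 := effect (false, b.+1, 0, false) s1.
  have A2 : agree b s0 s2 by apply: (agree_trans A1); exact: agree_effect.
  have [s3 [E3 A3 E3b E3i]] : exists s3, [/\ iter_rel (thead xs) body s2 s3,
      agree b s0 s3, s3 b = h (thead xs) & s3 b.+1 = thead xs].
    have : s2 b = h 0 by rewrite /s2 /= ltn_eqF.
    have : s2 b.+1 = 0 by rewrite /s2 /= eqxx A1 // s00.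
    have: 0 + thead xs = thead xs by [].
    elim: {1 3}(thead xs) {1 2 3}0 s2 A2 => [|n IHn] i s As /=.
      by rewrite addn0 => -> Ei Eb; exists s.
    move=> En Ei Eb.
    have ltix : i < thead xs by rewrite -En addnS ltnS leq_addr.
    have [S C] := gspec _ _ _ As Eb Ei.
    have [s4 E4 Eb4] := C _ (hS _ ltix).
    have [A4 Ei4 _] := S _ E4.
    have [||||s5 [E5 A5 E5b E5i]] := IHn i.+1 s4 => //.
      by rewrite addSnnS.
    by exists s5; split=> //; exists s4.
  exists s3 => //; exists s1 => //; exists s2 => //; exists s3.
    by exists (thead xs).
  by rewrite addn0 E3i A3 // Ex eqxx.
Qed.

(** The number of rounds of the star is the guessed minimum: a round passes only if the value of [f]
    is positive, and the evaluation after the star must give 0. *)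
Lemma compile_min k (f : recfun k.+1) : compile_spec f -> compile_spec (RMin f).
Proof.
move=> Hf ins b s0 xs b0 insb s00 E0.
have keep s : agree b s0 s -> s 0 = 0 /\ map s ins = xs.
  by move=> H; rewrite (H 0) // (agree_map H).
pose body := exec (PSeq (compile f (b :: ins) b.+1)
  (PSeq (positive b.+1 b.+2) (incr b))).
have fspec s i : agree b s0 s -> s b = i ->
    (forall s', exec (compile f (b :: ins) b.+1) s s' ->
      computes f [tuple of i :: xs] (s' b.+1) /\ agree b.+1 s s') /\
    (forall y, computes f [tuple of i :: xs] y ->
      exists2 s', exec (compile f (b :: ins) b.+1) s s' & s' b.+1 = y).
  move=> Hs Ei; have [s_0 Es] := keep _ Hs.
  by apply: Hf => //=; rewrite ?Ei ?Es // ltnSn (all_ltn_leq _ insb).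
have bspec s i : agree b s0 s -> s b = i ->
    (forall s', body s s' -> [/\ agree b s0 s', s' b = i.+1 &
        exists z, computes f [tuple of i :: xs] z.+1]) /\
    (forall z, computes f [tuple of i :: xs] z.+1 -> exists s', body s s').
  move=> Hs Ei; have [S C] := fspec _ _ Hs Ei.
  have [s_0 _] := keep _ Hs.
  split=> [s' [s1 /S[C1 A1] [s2 E2 [_ ->]]]|z /C[s1 E1 Ez]].
    have /exec_positive[||pos A2] := E2 => //; first by rewrite A1.
    split.
    + apply: agree_trans Hs _; apply: (agree_trans (agree_leq _ A1)) => //.
      apply: (agree_trans (agree_leq _ A2)); first by rewrite ltnW.
      exact: agree_effect.
    + by rewrite /= eqxx A2 // A1 // Ei addn1.
    + by exists (s1 b.+1).-1; rewrite prednK.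
  have [|||s2 E2] := @positive_exec b.+1 b.+2 s1 => //; last 2 first.
  + by rewrite Ez.
  + by exists (effect (false, b, b, true) s2); exists s1 => //; exists s2.
  by have [_ ->] := S _ E1.
pose s1 := effect (false, b, 0, false) s0.
have A1 : agree b s0 s1 by exact: agree_effect.
have E1b : s1 b = 0 by rewrite /s1 /= eqxx s00.
split=> [s' [_ [_ ->]] [s2 [n Hn] [s3 E3 [/eqP Z ->]]]|y [Cy Hy]].
- have [] := iter_rel_inv (I := fun i s => [/\ agree b s0 s, s b = i &
    forall j, j < i -> exists z, computes f [tuple of j :: xs] z.+1])
    (i := 0) _ _ Hn.
  + move=> i s s4 [As Ei H] /(proj1 (bspec _ _ As Ei)) [A4 E4 C4].
    split=> // j; rewrite ltnS leq_eqVlt => /orP[/eqP ->//|]; exact: H.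
  + by split.
  + rewrite add0n => A2 E2 H; have [S _] := fspec _ _ A2 E2.
    have [C3 A3] := S _ E3; split; last first.
      by apply: agree_trans A2 _; exact: agree_leq A3.
    rewrite /= A3 // E2; split=> //.
    by move: C3; rewrite Z A3 // (proj1 (keep _ A2)).
- have [s2 [E2 A2 E2b]] : exists s2, [/\ iter_rel y body s1 s2,
      agree b s0 s2 & s2 b = y].
    have: 0 + y = y by [].
    elim: {1 3}y {1 2}0 s1 A1 E1b => [|n IHn] i s As Eb /=.
      by rewrite addn0 => Ei; exists s; rewrite -Ei.
    move=> En; have ltiy : i < y by rewrite -En addnS ltnS leq_addr.
    have [S C] := bspec _ _ As Eb.
    have [z Cz] := Hy _ ltiy; have [s4 E4] := C _ Cz.
    have [A4 Ei4 _] := S _ E4.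
    have [|s5 [E5 A5 E5b]] := IHn i.+1 s4 A4 Ei4.
      by rewrite addSnnS.
    by exists s5; split=> //; exists s4.
  have [S C] := fspec _ _ A2 E2b.
  have [s3 E3 E3b] := C _ Cy; have [_ A3] := S _ E3.
  exists s3; last by rewrite A3.
  exists s1 => //; exists s2; first by exists y.
  by exists s3 => //; apply/exec_test; rewrite E3b A3 // (proj1 (keep _ A2)).
Qed.

Lemma compileP k (f : recfun k) : compile_spec f.
Proof.
elim: f => {k} [k|| k i|k l f IHf g IHg|k f IHf g IHg|k f IHf].
- move=> ins b s xs b0 insb s0 E; split=> [s' [_ ->]|y /= ->].
    by rewrite /= eqxx s0; split=> //; exact: agree_set.
  by eexists; first by []; rewrite /= eqxx s0.
- move=> ins b s xs b0 insb s0 E.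
  have Ex : s (head 0 ins) = thead xs.
    by rewrite /thead (tnth_nth 0) -E; case: ins {insb} E.
  split=> [s' [_ ->]|y /= ->].
    by rewrite /= eqxx Ex addn1; split=> //; exact: agree_set.
  by eexists; first by []; rewrite /= eqxx Ex addn1.
- move=> ins b s xs b0 insb s0 E.
  have Ex : s (nth 0 ins i) = tnth xs i.
    rewrite ?/thead (tnth_nth 0) -E (nth_map 0) //.
    by rewrite -(size_map s) E size_tuple.
  split=> [s' [_ ->]|y /= ->].
    by rewrite /= eqxx Ex addn0; split=> //; exact: agree_set.
  by eexists; first by []; rewrite /= eqxx Ex addn0.
- exact: compile_comp.
- exact: compile_prec.
- exact: compile_min.
Qed.

(** * Control graphs *)

HB.instance Definition _ := gen_eqMixin prog.

Record control (C : Type) := Control {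
  start_cell : C;
  instr_of : C -> option instr;
  next_cell : rel C;
  is_main : pred C
}.

Fixpoint trace C (M : control C) (c : nat -> C) (s : store) (t : nat) : store :=
  if t is t'.+1 then
    if instr_of M (c t') is Some a then effect a (trace M c s t')
    else trace M c s t'
  else s.

Definition computation C (M : control C) (c : nat -> C) (s : store) (T : nat) :=
  [/\ forall t, t < T -> next_cell M (c t) (c t.+1),
      forall t, t < T ->
        exists2 a, instr_of M (c t) = Some a & enabled a (trace M c s t)
    & instr_of M (c T) = None].

(** The store starts at 0 everywhere; the input [n] enters only as the time at which the first main
    cell is reached. *)
Definition accepts C (M : control C) (n : nat) : Prop :=
  exists T c, [/\ c 0 = start_cell M, computation M c (fun=> 0) T,
    n <= T, is_main M (c n) & forall t, t < n -> ~~ is_main M (c t)].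

Lemma trace_add C (M : control C) c s n t :
  trace M c s (n + t) = trace M (fun u => c (n + u)) (trace M c s n) t.
Proof. by elim: t => [|t /= <-]; rewrite ?addn0 ?addnS. Qed.

(** A continuation is the stack of programs still to be run; continuations serve as the points of
    the control graph. *)
Definition cont := seq prog.

Definition next_cont (x : cont) : seq cont :=
  match x with
  | [::] => [::]
  | PInstr _ :: k => [:: k]
  | PSeq P Q :: k => [:: [:: P, Q & k]]
  | PStar P :: k => [:: k; [:: P, PStar P & k]]
  end.

(** Unfolding a [PSeq] or a [PStar] takes a step of its own, under the test of register 0 against
    itself, which always passes; the empty stack is the halting point. *)
Definition cont_instr (x : cont) : option instr :=
  match x with
  | [::] => None
  | PInstr a :: _ => Some a
  | _ => Some (true, 0, 0, false)
  end.

(** A finite list of the stacks met until [k] is exposed. It is finite in spite of the star because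
    the body of [PStar P] is run on top of [PStar P :: k], which is already listed. *)
Fixpoint conts (P : prog) (k : cont) : seq cont :=
  (P :: k) :: match P with
              | PInstr _ => [::]
              | PSeq P Q => conts P (Q :: k) ++ conts Q k
              | PStar P => conts P (PStar P :: k)
              end.

Lemma mem_conts P k : P :: k \in conts P k.
Proof. by case: P => *; exact: mem_head. Qed.

Lemma conts_closed P k x y :
  x \in conts P k -> y \in next_cont x -> y = k \/ y \in conts P k.
Proof.
elim: P k x y => [a|P IHP Q IHQ|P IHP] k x y; rewrite [conts _ _]/= !in_cons.
- by case/orP => // /eqP -> /=; rewrite inE => /eqP; left.
- rewrite mem_cat => /or3P[/eqP -> /=|xP|xQ].
  + by rewrite inE => /eqP ->; right; rewrite mem_cat mem_conts orbT.
  + case/(IHP _ _ _ xP) => [->|yP]; right; rewrite mem_cat ?yP ?orbT //.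
    by rewrite mem_conts !orbT.
  + case/(IHQ _ _ _ xQ) => [->|yQ]; [by left|right].
    by rewrite mem_cat yQ !orbT.
- case/orP => [/eqP -> /=|xP].
  + rewrite !inE => /orP[/eqP|/eqP ->]; [by left|right].
    by rewrite mem_conts orbT.
  + by case/(IHP _ _ _ xP) => [->|yP]; right; rewrite ?eqxx ?yP ?orbT.
Qed.

Fixpoint execs (x : cont) (s s' : store) : Prop :=
  if x is P :: k then exists2 s1, exec P s s1 & execs k s1 s' else s' = s.

Lemma execs_step x y a s s' : y \in next_cont x -> cont_instr x = Some a ->
  enabled a s -> execs y (effect a s) s' -> execs x s s'.
Proof.
case: x => [|[b|P Q|P] k] //=.
- by rewrite inE => /eqP -> [->] ab H; exists (effect a s).
- rewrite inE => /eqP -> [<-] _ /= [s1 HP [s2 HQ Hk]].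
  by exists s2 => //; exists s1.
- rewrite !inE => /orP[]/eqP -> [<-] _.
    by move=> H; exists s => //; exists 0.
  move=> /= [s1 HP [s2 [n Hn] Hk]].
  by exists s2 => //; exists n.+1; exists s1.
Qed.

Inductive reaches : cont -> store -> store -> Prop :=
  | reaches_nil s : reaches [::] s s
  | reaches_step x y a s s' : y \in next_cont x -> cont_instr x = Some a ->
      enabled a s -> reaches y (effect a s) s' -> reaches x s s'.

Lemma exec_reaches P k s s1 s' :
  exec P s s1 -> reaches k s1 s' -> reaches (P :: k) s s'.
Proof.
elim: P k s s1 => [a|P IHP Q IHQ|P IHP] k s s1 /=.
- case=> ab -> H; by apply: (@reaches_step _ k a) => //; rewrite mem_head.
- case=> s2 HP HQ Hk.
  apply: (@reaches_step _ [:: P, Q & k] (true, 0, 0, false));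
    rewrite //= ?mem_head //.
    by rewrite addn0.
  by apply: IHP HP _; exact: IHQ HQ _.
- case=> n; elim: n s => [|n IHn] s /=.
    move=> -> Hk; apply: (@reaches_step _ k (true, 0, 0, false));
      rewrite //= ?mem_head //.
    by rewrite addn0.
  case=> s2 HP Hn Hk.
  apply: (@reaches_step _ [:: P, PStar P & k] (true, 0, 0, false)) => //=.
  + by rewrite !inE eqxx orbT.
  + by rewrite addn0.
  + by apply: IHP HP _; exact: IHn Hn Hk.
Qed.

Fixpoint prog_bound (m : nat) (P : prog) : bool :=
  match P with
  | PInstr (_, r, u, _) => (r < m) && (u < m)
  | PSeq P Q => prog_bound m P && prog_bound m Q
  | PStar P => prog_bound m P
  end.

Lemma conts_bound m P k x : 0 < m -> prog_bound m P -> all (prog_bound m) k ->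
  x \in conts P k -> all (prog_bound m) x.
Proof.
move=> m0; elim: P k => [a|P IHP Q IHQ|P IHP] k;
  rewrite [conts _ _]/= !in_cons [prog_bound _ _]/=.
- by move=> Ha Hk; case/orP => // /eqP -> /=; rewrite Hk andbT.
- case/andP=> HP HQ Hk; rewrite mem_cat => /or3P[/eqP -> /=||].
  + by rewrite HP HQ.
  + by apply: IHP; rewrite //= HQ.
  + exact: IHQ.
- move=> HP Hk /orP[/eqP -> /=|]; first by rewrite HP.
  by apply: IHP; rewrite //= HP.
Qed.

Lemma prog_bound_leq m m' P : m <= m' -> prog_bound m P -> prog_bound m' P.
Proof.
move=> le; elim: P => [[[[t r] u] i]|P IHP Q IHQ|P IHP] //=.
- by case/andP => lr lu; rewrite !(leq_trans _ le).
- by case/andP => /IHP -> /IHQ ->.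
Qed.

Lemma prog_bound_exists P : exists m, prog_bound m P.
Proof.
elim: P => [[[[t r] u] i]|P [m Hm] Q [m' Hm']|P [m Hm]] /=.
- by exists (maxn r.+1 u.+1); rewrite !leq_max !leqnn orbT.
- exists (maxn m m').
  by rewrite !(prog_bound_leq _ Hm, prog_bound_leq _ Hm') ?leq_max ?leqnn ?orbT.
- by exists m.
Qed.

Section ProgControl.
Variable P : prog.

Definition prog_conts : seq cont := [::] :: conts P [::].

Definition cont_of (k : 'I_(size prog_conts)) : cont := nth [::] prog_conts k.

Lemma cont_of_surj x : x \in prog_conts -> exists k, cont_of k = x.
Proof. by case/(nthP [::]) => k ltk <-; exists (Ordinal ltk). Qed.

Lemma cont_of_mem k : cont_of k \in prog_conts.
Proof. exact: mem_nth. Qed.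

Lemma prog_conts_closed x y :
  x \in prog_conts -> y \in next_cont x -> y \in prog_conts.
Proof.
rewrite in_cons => /orP[/eqP -> //|xP] /(conts_closed xP)[->|yP].
  exact: mem_head.
by rewrite in_cons yP orbT.
Qed.

(* [None] and [Some None] add 1 to register 1; the program is started by
   leaving them, hence with the number of loading steps in register 1. *)
Definition prog_cell : finType := option (option 'I_(size prog_conts)).

Definition prog_control : control prog_cell := {|
  start_cell := None;
  instr_of := fun c =>
    if c is Some (Some k) then cont_instr (cont_of k)
    else Some (false, 1, 1, true);
  next_cell := fun c c' =>
    match c, c' with
    | Some (Some k), Some (Some k') => cont_of k' \in next_cont (cont_of k)
    | Some (Some k), _ => false
    | _, Some (Some k') => cont_of k' == [:: P]
    | _, Some None => true
    | _, None => false
    end;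
  is_main := fun c => if c is Some (Some _) then true else false
|}.

Definition loaded (n : nat) : store := fun q => if q == 1 then n else 0.

Lemma loadedS n : effect (false, 1, 1, true) (loaded n) = loaded n.+1.
Proof. by apply/funext => -[|[|q]] //=; rewrite /loaded /= addn1. Qed.

Lemma loaded0 : loaded 0 = fun=> 0.
Proof. by apply/funext => -[|[|q]]. Qed.

Lemma trace_loaded c n : (forall t, t < n -> ~~ is_main prog_control (c t)) ->
  trace prog_control c (fun=> 0) n = loaded n.
Proof.
elim: n => [|n IHn] Hc; first by rewrite loaded0.
rewrite /= -loadedS -IHn => [|t /ltnW]; last exact: Hc.
by have := Hc n (ltnSn n); case: (c n) => [[k|]|].
Qed.

Lemma accepts_exec n : accepts prog_control n ->
  exists s', exec P (loaded n) s'.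
Proof.
case=> T [c [c0 [cS cI cT] nT cn Hc]].
have n0 : 0 < n by rewrite lt0n; apply: contraL cn => /eqP ->; rewrite c0.
have En : exists2 k, c n = Some (Some k) & cont_of k = [:: P].
  move: cn; case E: (c n) => [[k|]|] // _; exists k => //.
  have ltn1 : n.-1 < n by rewrite prednK.
  have := cS n.-1 (leq_trans ltn1 nT); rewrite prednK // E.
  by have := Hc _ ltn1; case: (c n.-1) => [[]|] //= _ /eqP.
have Hmain d : n + d <= T -> exists k, c (n + d) = Some (Some k).
  elim: d => [|d IHd]; first by case: En => k Ek _; exists k; rewrite addn0.
  rewrite addnS => lt; have [k Ek] := IHd (ltnW lt).
  by have := cS _ lt; rewrite Ek; case: (c _) => [[k'|]|] //= _; exists k'.
(* Induction on the number [e] of steps left, so that [execs] is rebuilt backwards from the empty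
   stack at time [T]. *)
have Hex e d : n + d + e = T -> forall k, c (n + d) = Some (Some k) ->
    execs (cont_of k) (trace prog_control c (fun=> 0) (n + d))
      (trace prog_control c (fun=> 0) T).
  elim: e d => [|e IHe] d Ed k Ek.
    move: cT; rewrite -Ed addn0 Ek /=; case: (cont_of k) => [|[?|? ?|?] ?] //.
  have ltT : n + d < T by rewrite -Ed addnS ltnS leq_addr.
  have [k' Ek'] := Hmain d.+1 ltac:(by rewrite addnS).
  have Ed' : n + d.+1 + e = T by rewrite -Ed addnS addSnnS.
  have := IHe _ Ed' _ Ek'; have := cS _ ltT; have [a] := cI _ ltT.
  rewrite -addnS Ek Ek' /= => Ea ena kk'; rewrite addnS /= Ek /= Ea.
  exact: execs_step.
have [k Ek EP] := En.
have := Hex (T - n) 0; rewrite addn0 subnKC // => /(_ erefl _ Ek).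
rewrite EP (trace_loaded Hc) /= => -[s' Hs' _]; by exists s'.
Qed.

Lemma exec_accepts n s' : 0 < n -> exec P (loaded n) s' ->
  accepts prog_control n.
Proof.
move=> n0 /exec_reaches /(_ (reaches_nil _)).
have : [:: P] \in prog_conts by rewrite in_cons mem_conts orbT.
pose lift (k : nat -> 'I_(size prog_conts)) t : prog_cell := Some (Some (k t)).
suff H x s : reaches x s s' -> x \in prog_conts -> exists T k,
    cont_of (k 0) = x /\ computation prog_control (lift k) s T.
  move=> PP /H /(_ PP) [T [k [k0 [kS kI kT]]]].
  (* Cell 0 is the start, cells 1 to n - 1 repeat the loading cell, and the path through the
     continuations follows; each of the first n steps adds 1 to register 1. *)
  pose c t : prog_cell := if t == 0 then None else
    if t < n then Some None else lift k (t - n).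
  have cn t : c (n + t) = lift k t.
    by rewrite /c addn_eq0 eqn0Ngt n0 /= ltnNge leq_addr addKn.
  have Hc t : t < n -> ~~ is_main prog_control (c t).
    by move=> lt; rewrite /c lt; case: ifP.
  have tr t : trace prog_control c (fun=> 0) (n + t) =
      trace prog_control (lift k) (loaded n) t.
    by rewrite trace_add trace_loaded //; congr trace; exact/funext.
  exists (n + T), c; split=> //; [|exact: leq_addr|by rewrite -[n]addn0 cn].
  have split_lt t : t < n + T -> t < n \/ exists2 u, t = n + u & u < T.
    case: (ltnP t n) => [|le]; first by left.
    by rewrite -{1}(subnKC le) ltn_add2l => lt; right; exists (t - n);
      rewrite ?subnKC.
  split=> [t /split_lt[lt|[u -> ltu]]|t /split_lt[lt|[u -> ltu]]|].
  + rewrite /c lt; case: (ltnP t.+1 n) => [_|le]; first by case: ifP.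
    have -> : t.+1 = n by apply/eqP; rewrite eqn_leq lt le.
    by rewrite subnn (gtn_eqF n0) /=; case: ifP => _; apply/eqP.
  + by rewrite -addnS !cn; exact: kS.
  + by exists (false, 1, 1, true) => //; rewrite /c lt; case: ifP.
  + by rewrite cn tr; exact: kI.
  + by rewrite cn.
elim=> {x s s'} [s|x y a s s' xy Ea ena _ IH] xP.
  by have [k Ek] := cont_of_surj xP; exists 0, (fun=> k); split; last by
    split=> //=; rewrite Ek.
have [T [k [k0 [kS kI kT]]]] := IH (prog_conts_closed xP xy).
have [kx Ex] := cont_of_surj xP.
pose k' t := if t is t'.+1 then k t' else kx.
have tr t : trace prog_control (lift k') s t.+1 =
    trace prog_control (lift k) (effect a s) t.
  by rewrite -add1n trace_add /= Ex Ea.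
exists T.+1, k'; split=> //; split=> // [[_|t]|[_|t]].
- by rewrite /= Ex k0.
- exact: kS.
- by exists a => //=; rewrite Ex.
- by move/kI; rewrite tr.
Qed.

(** [1 < m] covers register 1 of the loading cells and register 0 of the tests that unfold [PSeq]
    and [PStar]. *)
Lemma prog_control_bound m c t r u i : 1 < m -> prog_bound m P ->
  instr_of prog_control c = Some (t, r, u, i) -> (r < m) && (u < m).
Proof.
move=> m1 Pm; case: c => [[k|]|] /=; last 2 first.
- by case=> _ <- <- _; rewrite m1.
- by case=> _ <- <- _; rewrite m1.
have m0 := ltnW m1.
have : all (prog_bound m) (cont_of k).
  have := cont_of_mem k; rewrite in_cons => /orP[/eqP ->|] //.
  exact: conts_bound.
case: (cont_of k) => [|[a|Q1 Q2|Q] x] //=.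
- by case/andP => + _ [Ea]; rewrite Ea.
- by move=> _ [_ <- <- _]; rewrite m0.
- by move=> _ [_ <- <- _]; rewrite m0.
Qed.

End ProgControl.

(** * Runs and their costs *)

Section Runs.
Local Open Scope ring_scope.
Variables (R : realType) (m k : nat) (A : pta m k).
Implicit Types (rho : run R A) (i : 'I_k).

Definition state_at rho j : state R A := start (suffix_run rho j).

Definition cost_at i rho j : R := run_cost i (prefix_run rho j).

Lemma suffix_run_add rho a b :
  suffix_run (suffix_run rho a) b = suffix_run rho (a + b).
Proof.
by rewrite /suffix_run /= drop_drop addnC takeD map_cat last_cat.
Qed.

Lemma suffix_run0 rho : suffix_run rho 0 = rho.
Proof. by case: rho => s p; rewrite /suffix_run /= take0 drop0. Qed.

Lemma path_cost_cat i s (p q : seq (step R A)) :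
  path_cost i s (p ++ q) =
  path_cost i s p + path_cost i (last s [seq x.2 | x <- p]) q.
Proof.
elim: p s => [|[[t e] s'] p IHp] s /=; first by rewrite add0r.
by rewrite IHp addrA.
Qed.

Lemma cost_at_suffix i rho a b :
  cost_at i (suffix_run rho a) b = cost_at i rho (a + b) - cost_at i rho a.
Proof.
by rewrite /cost_at /run_cost /= [in RHS]takeD path_cost_cat addrC addKr.
Qed.

(** Rephrases the until in positions of the whole run, where costs become differences of [cost_at]
    and nested suffixes disappear. *)
Lemma sat_until rho a phi i o c psi :
  sat (suffix_run rho a) (WUntil phi i o c psi) <->
  exists b, [/\ (a < b <= run_length rho)%N, sat (suffix_run rho b) psi,
    forall b', (a < b' < b)%N -> sat (suffix_run rho b') phi
    & holds o (cost_at i rho b - cost_at i rho a) c%:R].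
Proof.
split=> [[n [/andP[n0 len] H2 H1 Hc]]|[b [/andP[ab leb] H2 H1 Hc]]].
  exists (a + n)%N; split.
  - rewrite -[X in (X < _)%N]addn0 ltn_add2l n0 /=.
    move: len; rewrite /run_length size_drop => len.
    by rewrite -leq_psubRL.
  - by rewrite -suffix_run_add.
  - move=> b' /andP[ab' lb']; have := H1 (b' - a)%N.
    rewrite suffix_run_add subnKC ?(ltnW ab') //; apply.
    by rewrite subn_gt0 ab' ltn_subLR // ltnW.
  - by rewrite -cost_at_suffix.
exists (b - a)%N; split.
- by rewrite subn_gt0 ab /run_length size_drop leq_sub2r.
- by rewrite suffix_run_add subnKC // ltnW.
- move=> n /andP[n0 ltn]; rewrite suffix_run_add; apply: H1.
  by rewrite -{1}[a]addn0 ltn_add2l n0 -ltn_subRL.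
- rewrite -[run_cost _ _]/(cost_at i (suffix_run rho a) (b - a)).
  by rewrite cost_at_suffix subnKC // ltnW.
Qed.

Lemma run_step rho j : is_run rho -> (j < run_length rho)%N ->
  exists t e, mixed_move (state_at rho j) t e (state_at rho j.+1) /\
    forall i, cost_at i rho j.+1 = cost_at i rho j +
      (t * (lcost i (state_at rho j).1)%:R + (ecost i e)%:R).
Proof.
case: rho => s p; rewrite /is_run /run_length /= => + ltj.
suff: is_path s p -> exists t e,
    mixed_move (last s [seq x.2 | x <- take j p]) t e
      (last s [seq x.2 | x <- take j.+1 p]) /\
    forall i, path_cost i s (take j.+1 p) = path_cost i s (take j p) +
      (t * (lcost i (last s [seq x.2 | x <- take j p]).1)%:R + (ecost i e)%:R).
  by [].
elim: p s j ltj => [|[[t e] s'] p IHp] s [|j] //= ltj [Hm Hp].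
  by exists t, e; rewrite take0 /=; split=> // i; rewrite add0r addr0.
have [t' [e' [Hm' Hc]]] := IHp s' j ltj Hp; exists t', e'; split=> // i.
by rewrite Hc addrA.
Qed.

Lemma is_path_cat s (p q : seq (step R A)) :
  is_path s (p ++ q) <->
  is_path s p /\ is_path (last s [seq x.2 | x <- p]) q.
Proof.
elim: p s => [|[[t e] s'] p IHp] s /=; first by split=> [|[]].
by rewrite IHp; split=> [[? []]|[[]]].
Qed.

Lemma is_run_mkseq (st : nat -> state R A) (t : nat -> R)
    (e : nat -> edge (nloc A) m) N :
  (forall j, (j < N)%N -> mixed_move (st j) (t j) (e j) (st j.+1)) ->
  let rho := Run (st 0%N) (mkseq (fun j => (t j, e j, st j.+1)) N) in
  [/\ is_run rho, run_length rho = N &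
      forall j, (j <= N)%N -> state_at rho j = st j].
Proof.
move=> Hm rho.
have Hlast n : last (st 0%N)
    [seq x.2 | x <- mkseq (fun j => (t j, e j, st j.+1)) n] = st n.
  by case: n => // n; rewrite mkseqS map_rcons last_rcons.
split; last 2 first.
- by rewrite /run_length size_mkseq.
- move=> j lej.
  by rewrite /state_at /= -map_take take_iota (minn_idPl lej) Hlast.
rewrite /is_run /rho {rho} /=.
elim: N Hm => // n IHn Hm; rewrite mkseqS -cats1 is_path_cat; split.
  by apply: IHn => j ltj; apply: Hm; rewrite ltnW.
by rewrite Hlast /=; split=> //; exact: Hm.
Qed.

End Runs.

(** * The automaton *)

Lemma ltn_modS j d : (0 < d)%N -> ((j %% d).+1 < d)%N = ~~ (d %| j.+1)%N.
Proof.
move=> d0; have ltd := ltn_pmod j d0.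
rewrite ltn_neqAle ltd andbT; congr (~~ _); apply/eqP/idP => [E|].
  by rewrite (divn_eq j d) -addnS E dvdn_add ?dvdn_mull.
rewrite {1}(divn_eq j d) -addnS dvdn_addr ?dvdn_mull // => /dvdn_leq le.
by apply/eqP; rewrite eqn_leq ltd le.
Qed.

Section Automaton.
Local Open Scope ring_scope.
Variables (C : finType) (M : control C) (m : nat).
Local Notation K := m.+1.

(* [(c, r, b)]: slot r of the cycle simulating the cell c, before ([b = false])
   or after ([b = true]) the event of the slot. *)
Definition loc : finType := (C * 'I_K * bool)%type.

(** Every event takes place before the slot ends. In the starting cell, slot 0 must get a positive
    unit and the other slots the value 0, so all registers start at 0. *)
Definition event_guard (c : C) (r : 'I_K) : constr 1 :=
  CAnd (CAtom ord0 Lt 1)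
    (CAtom ord0 (if c == start_cell M then if r == ord0 then Gt else Eq
                 else Ge) 0).

Definition slot_next (p p' : C * 'I_K) : bool :=
  if (p.2.+1 < K)%N then (p'.1 == p.1) && (p'.2 == p.2.+1 :> nat)
  else next_cell M p.1 p'.1 && (p'.2 == 0%N :> nat).

Definition event_edge (p : C * 'I_K) : edge #|loc| 1 :=
  (enum_rank ((p, false) : loc), event_guard p.1 p.2, set0,
   enum_rank ((p, true) : loc)).

Definition slot_edge (p : (C * 'I_K) * (C * 'I_K)) : edge #|loc| 1 :=
  (enum_rank ((p.1, true) : loc), CAtom ord0 Eq 1, setT,
   enum_rank ((p.2, false) : loc)).

(** The labels up to [K] are taken: 0 marks main cells and r + 1 marks slot r. The shift makes these
    labels fresh. *)
Definition source_label (p : C * 'I_K) : nat :=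
  (K.+1 + enum_rank ((p, true) : loc))%N.

Definition red_pta : pta 1 2 := {|
  nloc := #|loc|;
  init := enum_rank ((start_cell M, ord0, false) : loc);
  edges := [seq event_edge p | p <- enum {: C * 'I_K}] ++
           [seq slot_edge p | p <- enum {: (C * 'I_K) * (C * 'I_K)}
                            & slot_next p.1 p.2];
  Defs.inv := fun=> CAtom ord0 Ge 0;
  lcost := fun i q =>
    let: (c, r, b) := enum_val q in
    if [&& i != ord0, r == ord0 & ~~ b] then 0%N else 1%N;
  ecost := fun _ _ => 0%N;
  label := fun q =>
    let: (c, r, b) := enum_val q in
    (if is_main M c then [:: 0%N] else [::]) ++
    (if b then [:: r.+1; source_label (c, r)] else [::])
|}.

Lemma red_pta_stopwatch i : stopwatch red_pta i.
Proof.
by move=> q /=; case: (enum_val q) => -[c r] b; case: ifP; [left|right].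
Qed.

(** * Moves and profiles of runs *)

Section Run.
Variable R : realType.
Implicit Types (s : state R red_pta) (rho : run R red_pta).

Lemma mixed_move_red s t e s' : mixed_move s t e s' ->
  let: (p, b) := enum_val s.1 in
  0 <= t /\
  if b then exists p', [/\ enum_val s'.1 = (p', false), slot_next p p',
    s.2 ord0 + t = 1 & s'.2 ord0 = 0]
  else [/\ enum_val s'.1 = (p, true), s'.2 ord0 = s.2 ord0 + t &
    csat s'.2 (event_guard p.1 p.2)].
Proof.
case=> _ [t0 _ ->] [+ + + -> _] /=.
rewrite mem_cat => /orP[/mapP[p _ ->]|/mapP[[p p'] + ->]].
  rewrite /src /= => <- Hg; rewrite !enum_rankK; split=> //.
  rewrite ffunE in_set0 ffunE; split=> //.
  by move: Hg; rewrite /guard /= !ffunE.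
rewrite mem_filter => /andP[/= nxt _]; rewrite /src /= => <- Hg.
rewrite !enum_rankK; split=> //; exists p'; split=> //.
  by move: Hg; rewrite /= ffunE.
by rewrite ffunE in_setT.
Qed.

Lemma mixed_move_event (p : C * 'I_K) (t : R) :
  csat [ffun=> t] (event_guard p.1 p.2) -> 0 <= t ->
  @mixed_move R 1 2 red_pta (enum_rank ((p, false) : loc), [ffun=> 0]) t
    (event_edge p) (enum_rank ((p, true) : loc), [ffun=> t]).
Proof.
move=> Hg t0; exists (enum_rank ((p, false) : loc), [ffun=> t]).
  split=> //= [t' /andP[t'0 _]|]; first by rewrite !ffunE add0r.
  by congr pair; apply/ffunP => x; rewrite !ffunE add0r.
split=> //=.
- by rewrite mem_cat map_f // mem_enum.
- by congr pair; apply/ffunP => x; rewrite !ffunE in_set0.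
- by rewrite ffunE.
Qed.

Lemma mixed_move_slot (p p' : C * 'I_K) (v : R) :
  slot_next p p' -> 0 <= v <= 1 ->
  @mixed_move R 1 2 red_pta (enum_rank ((p, true) : loc), [ffun=> v]) (1 - v)
    (slot_edge (p, p')) (enum_rank ((p', false) : loc), [ffun=> 0]).
Proof.
move=> nxt /andP[v0 v1]; exists (enum_rank ((p, true) : loc), [ffun=> 1]).
  split=> /= [|t' /andP[t'0 _]|]; first by rewrite subr_ge0.
    by rewrite !ffunE addr_ge0.
  by congr pair; apply/ffunP => x; rewrite !ffunE addrC subrK.
split=> //=.
- rewrite mem_cat; apply/orP; right; apply: map_f.
  by rewrite mem_filter /= nxt mem_enum.
- by rewrite ffunE.
- by congr pair; apply/ffunP => x; rewrite !ffunE in_setT.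
- by rewrite ffunE.
Qed.

Definition event_time rho (j : nat) : R := (state_at rho j.*2.+1).2 ord0.

Definition cell_at rho (t : nat) : C :=
  (enum_val (state_at rho (t * K).*2).1).1.1.

(** The time for which the second cost has been stopped during the first [l] slots, hence the gap
    between the two costs. *)
Definition unit_time (V : nat -> R) (l : nat) : R :=
  \sum_(j < l) (if (K %| j)%N then V j else 0).

(* The profile of a run of N steps: the cell c_t of the t-th cycle, and the
   clock value V_j at the event of the j-th slot, which is reached at position
   2j + 1. *)
Definition profile rho (c : nat -> C) (V : nat -> R) : Prop :=
  [/\ forall i, (i <= run_length rho)%N -> [/\
        enum_val (state_at rho i).1 =
          (c (i./2 %/ K)%N, inord (i./2 %% K), odd i),
        cost_at ord0 rho i = (i./2)%:R + (if odd i then V i./2 else 0)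
      & cost_at ord_max rho i = cost_at ord0 rho i - unit_time V (uphalf i)],
      forall j, (j.*2.+1 <= run_length rho)%N -> 0 <= V j < 1 /\
        (c (j %/ K)%N = start_cell M ->
           if (j %% K == 0)%N then 0 < V j else V j == 0),
      c 0%N = start_cell M
    & forall t, ((t.+1 * K).*2 <= run_length rho)%N ->
        next_cell M (c t) (c t.+1)].

Lemma profile_exists rho : is_run rho -> start rho = init_state R red_pta ->
  profile rho (cell_at rho) (event_time rho).
Proof.
move=> Hrun Hstart; set c := cell_at rho; set V := event_time rho.
have s0 : state_at rho 0 = init_state R red_pta.
  by rewrite /state_at suffix_run0.
have c0 : c 0%N = start_cell M.
  by rewrite /c /cell_at mul0n s0 /= enum_rankK.
(* The induction needs the profile together with the clock: it is 0 when a slot starts and [V j]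
   just after its event. Even positions are left by events, odd ones by ends of slots. *)
pose I i := [/\
    enum_val (state_at rho i).1 = (c (i./2 %/ K)%N, inord (i./2 %% K), odd i),
    (state_at rho i).2 ord0 = if odd i then V i./2 else 0,
    cost_at ord0 rho i = (i./2)%:R + (if odd i then V i./2 else 0)
  & cost_at ord_max rho i = cost_at ord0 rho i - unit_time V (uphalf i)].
have slotS j p' : slot_next (c (j %/ K)%N, inord (j %% K)) p' ->
    enum_val (state_at rho j.+1.*2).1 = (p', false) ->
    p' = (c (j.+1 %/ K)%N, inord (j.+1 %% K)) /\
    ((K %| j.+1)%N -> next_cell M (c (j %/ K)%N) (c (j.+1 %/ K)%N)).
  have ltK := ltn_pmod j (ltn0Sn m).
  rewrite /slot_next /= inordK // divnS // modnS //.
  rewrite ltn_modS //.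
  case: p' => p r; case: ifP => /= [ndvd /andP[/eqP -> /eqP Er] _|].
    rewrite (negbTE ndvd) add0n; split=> //.
    suff -> : r = inord (j %% K).+1 by [].
    by apply: val_inj; rewrite /= inordK // -Er ltn_ord.
  move=> /negbFE dvd /andP[nx /eqP Er] E; rewrite dvd add1n.
  have Ep : p = c (j %/ K).+1.
    have Ej : ((j %/ K).+1 * K = j.+1)%N.
      by have := divnK dvd; rewrite divnS // dvd add1n.
    by rewrite /c /cell_at Ej E.
  rewrite -Ep; split=> //; suff -> : r = inord 0 by [].
  by apply: val_inj; rewrite /= inordK.
have unitS j : unit_time V j.+1 =
    unit_time V j + (if (K %| j)%N then V j else 0).
  by rewrite /unit_time big_ord_recr.
have step j : (j.*2 < run_length rho)%N -> I j.*2 ->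
    I j.*2.+1 /\ (0 <= V j < 1 /\ (c (j %/ K)%N = start_cell M ->
           if (j %% K == 0)%N then 0 < V j else V j == 0)).
  move=> lt; rewrite /I /= uphalf_double doubleK odd_double /=.
  move=> [E1 E2 E3 E4].
  have [t [e [/mixed_move_red + Ec]]] := run_step Hrun lt.
  rewrite E1 => -[t0 [E1' E2' [V1 Vg]]].
  have EV : V j = t by rewrite /V /event_time E2' E2 add0r.
  have := Ec ord0; have := Ec ord_max; rewrite /= !E1 /= => Ec1 Ec0.
  have Eo : (inord (j %% K) == ord0 :> 'I_K) = (K %| j)%N.
    by rewrite -val_eqE /= inordK ?ltn_pmod.
  rewrite Eo andbT in Ec1.
  rewrite unitS; split; first split=> //.
  - by rewrite Ec0 E3 EV !addr0 mulr1.
  (* In slot 0 the second cost stands still for [V j], the very term that [unit_time] gains; in the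
     other slots both costs grow alike. *)
  - rewrite Ec1 Ec0 E4 EV; case: ifP => _; lra.
  rewrite E2' E2 add0r -EV /= in V1 Vg.
  rewrite V1 EV t0; split=> // Ec'; move: Vg.
  rewrite Ec' eqxx Eo -[(_ %% _ == 0)%N]/(K %| j)%N -EV.
  by case: ifP => _ /=; [|move->].
have step' j : (j.*2.+1 < run_length rho)%N -> I j.*2.+1 ->
    I j.+1.*2 /\
    ((K %| j.+1)%N -> next_cell M (c (j %/ K)%N) (c (j.+1 %/ K)%N)).
  move=> lt; rewrite /I /= uphalf_double doubleK odd_double /=.
  move=> [E1 E2 E3 E4].
  have [t [e [/mixed_move_red + Ec]]] := run_step Hrun lt.
  rewrite E1 => -[t0 [p' [E1' nxt Et E2']]].
  have [Ep' ndvd] := slotS _ _ nxt E1'.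
  rewrite -doubleS in E1' E2'.
  split=> //; rewrite E1' E2' Ep'; split=> //.
    have := Ec ord0; rewrite -doubleS => ->; rewrite /= E1 E3 /=.
    by rewrite -E2 -natr1; lra.
  have := Ec ord_max; have := Ec ord0; rewrite -doubleS => -> ->.
  by rewrite /= E1 /= andbF E4; lra.
have Iall i : (i <= run_length rho)%N -> I i.
  elim: i => [|i IHi] lei.
    split; rewrite ?s0 /= ?enum_rankK ?div0n ?mod0n ?c0 ?ffunE //.
    - suff -> : ord0 = inord 0 :> 'I_K by [].
      by apply: val_inj; rewrite /= inordK.
    - by rewrite /cost_at /run_cost /= take0 addr0.
    - by rewrite /cost_at /run_cost /= take0 /unit_time big_ord0 subr0.
  move: lei (IHi (ltnW lei)); rewrite -{1 2 3}(odd_double_half i).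
  case: odd => lei Ii; first by have [] := step' _ lei Ii.
  by have [] := step _ lei Ii.
split=> [i /Iall[]|j lej||t let_] //.
- by have [] := step _ lej (Iall _ (ltnW lej)).
(* Cycle t + 1 is entered on leaving slot (t + 1) K - 1, the last one of cycle t. *)
- have ltt : (((t.+1 * K).-1).*2.+1 < run_length rho)%N.
    by rewrite -doubleS.
  have [_] := step' _ ltt (Iall _ (ltnW ltt)).
  rewrite prednK // dvdn_mull // mulnK // => /(_ isT).
  by rewrite mulSn addnC /= addnS /= divnMDl // divn_small // addn0.
Qed.

End Run.
End Automaton.

(** * The formula *)

Lemma half_double1 j : j.*2.+1./2 = j.
Proof. exact: uphalf_double. Qed.

Definition wtrue : wmtl 2 := WOr (WAtom 2 0) (WNot (WAtom 2 0)).

Definition load_formula (n : nat) : wmtl 2 :=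
  WUntil (WNot (WAtom 2 0)) ord0 Eq n (WAtom 2 0).

Section Formula.
Local Open Scope ring_scope.
Variables (C : finType) (M : control C) (m : nat).
Local Notation K := m.+1.

(* [(s, i, w)]: the value of slot w in the next cycle is that of slot s in the
   current one, plus one unit if i. *)
Definition constraints (c : C) : seq (nat * bool * nat) :=
  if instr_of M c is Some (t, r, u, i) then
    (u.+1, i, r.+1) :: [seq (q, false, q) | q <- iota 0 K & t || (q != r.+1)]
  else [::].

Definition target_formula (x : nat * bool * nat) : wmtl 2 :=
  let: (s, i, w) := x in
  WUntil wtrue (if i then ord_max else ord0) Eq (K + w - s) (WAtom 2 w.+1).

Definition violation (c : C) (x : nat * bool * nat) : wmtl 2 :=
  WNot (WOr (WNot (WAtom 2 (source_label (c, inord x.1.1 : 'I_K))))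
            (target_formula x)).

(** An until with [wtrue] on the left and the bound [>= 0] means eventually. It skips position 0,
    but that position precedes every event. *)
Definition bad_formula : wmtl 2 :=
  WUntil wtrue ord0 Ge 0
    (foldr (@WOr 2) (WNot wtrue)
       [seq violation p.1 p.2
          | p <- [seq (c, x) | c <- enum C, x <- constraints c]]).

(** * Meaning of the formulas on a run with a given profile *)

Section Run.
Variable R : realType.
Variables (rho : run R (red_pta M m)) (c : nat -> C) (V : nat -> R).
Hypothesis prof : profile rho c V.
Hypothesis m2 : (2 <= m)%N.
Hypothesis instr_bound : forall c t r u i,
  instr_of M c = Some (t, r, u, i) -> (r < m)%N && (u < m)%N.
Local Notation N := (run_length rho).

Lemma sat_wtrue i : sat (suffix_run rho i) wtrue.
Proof. by rewrite /=; exact: EM. Qed.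

Lemma sat_main i : (i <= N)%N ->
  sat (suffix_run rho i) (WAtom 2 0) <-> is_main M (c (i./2 %/ K)%N).
Proof.
case: prof => + _ _ _ => /[apply] -[E _ _].
rewrite /= -/(state_at rho i) E mem_cat.
by case: is_main; case: odd; split.
Qed.

Lemma sat_slot i w : (i <= N)%N -> (w < K)%N ->
  sat (suffix_run rho i) (WAtom 2 w.+1) <-> odd i /\ (i./2 %% K)%N = w.
Proof.
case: prof => + _ _ _ => /[apply] -[E _ _] ltw.
rewrite /= -/(state_at rho i) E mem_cat /source_label.
have -> : (w.+1 \in if is_main M (c (i./2 %/ K)%N) then [:: 0%N] else [::])
    = false by case: ifP.
case: odd; last by split=> [|[]].
rewrite !inE /= inordK ?ltn_pmod // !addSn !eqSS.
split=> [/orP[/eqP ->//|]|[_ ->]].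
  by move=> /eqP Ew; move: ltw; rewrite Ew ltnS leqNgt ltnS leq_addr.
by rewrite eqxx.
Qed.

Lemma sat_source i c' s : (i <= N)%N -> (s < K)%N ->
  sat (suffix_run rho i) (WAtom 2 (source_label (c', inord s : 'I_K))) <->
  [/\ odd i, c (i./2 %/ K)%N = c' & (i./2 %% K)%N = s].
Proof.
case: prof => + _ _ _ => /[apply] -[E _ _] lts.
rewrite /= -/(state_at rho i) E mem_cat.
have -> : (source_label (c', inord s : 'I_K)
    \in if is_main M (c (i./2 %/ K)%N) then [:: 0%N] else [::]) = false.
  by case: ifP.
case: odd; last by split=> [|[]].
rewrite !inE /= inordK ?ltn_pmod //; split.
  case/orP => [/eqP|].
    rewrite /source_label !addSn => -[Es]; have := ltn_pmod i./2 (ltn0Sn m).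
    by rewrite -Es ltnS leqNgt ltnS leq_addr.
  rewrite /source_label eqn_add2l val_eqE (inj_eq enum_rank_inj) !xpair_eqE.
  rewrite andbT => /andP[/eqP -> /eqP Es]; split=> //.
  by have := congr1 val Es; rewrite /= !inordK ?ltn_pmod.
by case=> _ -> ->; rewrite eqxx orbT.
Qed.

Lemma unit_time_slot t w : (w < K)%N ->
  unit_time m V (t * K + w).+1 = \sum_(u < t.+1) V (u * K)%N.
Proof.
have S j : unit_time m V j.+1 =
    unit_time m V j + (if (K %| j)%N then V j else 0).
  by rewrite /unit_time big_ord_recr.
elim: t w => [|t IHt]; elim=> [|w IHw] ltw.
- rewrite S big_ord1 /= /unit_time big_ord0 add0r.
  by rewrite !mul0n.
- rewrite addnS S -IHw 1?ltnW // mul0n add0n.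
  by rewrite gtnNdvd // addr0.
- rewrite addn0 S dvdn_mull // big_ord_recr /=; congr (_ + _).
  by rewrite -(IHt m) // mulSn addnC addnS.
- rewrite addnS S -IHw 1?ltnW // -addnS dvdn_addr ?dvdn_mull //.
  by rewrite gtnNdvd // addr0.
Qed.

Lemma event_costs t s : (s < K)%N -> ((t * K + s).*2.+1 <= N)%N ->
  cost_at ord0 rho (t * K + s).*2.+1 =
    (t * K)%:R + s%:R + V (t * K + s)%N /\
  cost_at ord_max rho (t * K + s).*2.+1 =
    (t * K)%:R + s%:R + V (t * K + s)%N - \sum_(u < t.+1) V (u * K)%N.
Proof.
case: prof => + _ _ _ => H lts /H [_ -> ->].
rewrite /= uphalf_double odd_double /= doubleK unit_time_slot //.
by rewrite natrD.
Qed.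

Lemma event_time_bound j : (j.*2.+1 <= N)%N -> 0 <= V j < 1.
Proof. by case: prof => _ H _ _ /H[]. Qed.

(** The second cost loses less than 1 per cycle, so it cannot confuse distant cycles. *)
Lemma unit_sum_bound t d w : (((t + d) * K + w).*2.+1 <= N)%N ->
  \sum_(u < (t + d).+1) V (u * K)%N - \sum_(u < t.+1) V (u * K)%N <= d%:R.
Proof.
elim: d w => [|d IHd] w; first by rewrite addn0 subrr.
move=> le; rewrite addnS big_ord_recr /= -natr1 addrAC lerD //.
  by apply: (IHd w); apply: leq_trans le; rewrite addnS mulSn; lia.
have /event_time_bound/andP[_ /ltW//] : (((t + d).+1 * K).*2.+1 <= N)%N.
by apply: leq_trans le; rewrite addnS; lia.
Qed.

(** The label only says that the witness is slot [w] of some cycle. As values lie in [0, 1) and K is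
    at least 3, the cost bound leaves only the next cycle, where it becomes the stated equation: the
    second cost lacks exactly the unit of that cycle. *)
Lemma sat_target t s w (i : bool) : (s < K)%N -> (w < K)%N ->
  ((t * K + s).*2.+1 <= N)%N ->
  sat (suffix_run rho (t * K + s).*2.+1) (target_formula (s, i, w)) <->
  ((t.+1 * K + w).*2.+1 <= N)%N /\
  V (t.+1 * K + w)%N = V (t * K + s)%N + (if i then V (t.+1 * K)%N else 0).
Proof.
move=> lts ltw les; have [Cs0 Cs1] := event_costs lts les.
have Bs := event_time_bound les.
have EK : (K + w - s)%:R = K%:R + w%:R - s%:R :> R.
  by rewrite natrB ?natrD // ltnW // ltn_addr.
have K3 : 3 <= K%:R :> R by rewrite (ler_nat _ 3).
have ES : (t.+1 * K)%:R = (t * K)%:R + K%:R :> R by rewrite mulSn addnC natrD.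
rewrite /target_formula sat_until; split=> [[b [/andP[ltb leb]]]|[lew EV]].
- case/sat_slot => // ob Ew _.
  have [t' Eb] : exists t', b = (t' * K + w).*2.+1.
    exists (b./2 %/ K)%N.
    by rewrite -{1}(odd_double_half b) ob {1}(divn_eq b./2 K) Ew.
  rewrite {b ob Ew}Eb in ltb leb *.
  have [Cw0 Cw1] := event_costs ltw leb.
  have Bw := event_time_bound leb.
  have [lett'|] := leqP t t'; last first.
    move=> lt; suff: (t' * K + w <= t * K + s)%N by lia.
    have : (t'.+1 * K <= t * K)%N by rewrite leq_mul2r lt orbT.
    by rewrite mulSn; lia.
  move: lett'; rewrite leq_eqVlt => /orP[/eqP E|].
    (* Within the same cycle, two values in [0, 1) would have to differ by [K]. *)
    by case: i; rewrite /= EK ?Cw0 ?Cw1 ?Cs0 ?Cs1 -E in leb Cw0 Cw1 Bw *; lra.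
  move=> /subnKC; move: (t' - t.+1)%N => d Ed.
  rewrite -{t'}Ed in ltb leb Cw0 Cw1 Bw *.
  have EX : ((t.+1 + d) * K)%:R = (t * K)%:R + K%:R + (d * K)%:R :> R.
    by rewrite mulnDl natrD ES.
  case: d {ltb} EX leb Cw0 Cw1 Bw => [|d] EX leb Cw0 Cw1 Bw.
    rewrite addn0 in EX leb Cw0 Cw1 Bw *; case: i => /=; rewrite EK.
      by rewrite Cw1 Cs1 ES big_ord_recr /=; split=> //; lra.
    by rewrite Cw0 Cs0 ES; split=> //; lra.
  (* The witness is d + 2 cycles ahead. At most d + 2 units are lost and values differ by less than
     1, so (d + 1) K would be less than d + 3, against K >= 3. *)
  have : (d.+1 * 3)%:R <= (d.+1 * K)%:R :> R by rewrite ler_nat leq_mul2l.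
  rewrite natrM -natr1.
  have : 0 <= d%:R :> R by [].
  case: i => /=; rewrite EK ?Cw0 ?Cs0 ?Cw1 ?Cs1 EX; last by lra.
  have := @unit_sum_bound t d.+2 w; rewrite -addSnnS => /(_ leb).
  by rewrite -!natr1; lra.
- exists (t.+1 * K + w).*2.+1; split.
  + by rewrite lew mulSn; lia.
  + apply/sat_slot => //; rewrite half_double1 modnMDl modn_small //.
    by rewrite oddS odd_double.
  + by move=> *; exact: sat_wtrue.
  + have [Cw0 Cw1] := event_costs ltw lew.
    case: i EV => /= EV; rewrite EK.
      by rewrite Cw1 Cs1 ES big_ord_recr /= EV; lra.
    by rewrite Cw0 Cs0 ES EV; lra.
Qed.

Lemma constraints_bound c' s i w : (s, i, w) \in constraints c' ->
  (s < K)%N /\ (w < K)%N.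
Proof.
rewrite /constraints; case E: instr_of => [[[[t r] u] j]|] //.
have /andP[rm um] := instr_bound E.
rewrite in_cons => /orP[/eqP[-> _ ->]|]; first by rewrite !ltnS.
by move=> /mapP[q + [-> _ ->]]; rewrite mem_filter mem_iota add0n => /and3P[].
Qed.

Lemma sat_foldr_or (T : eqType) (f : T -> wmtl 2) i phi (l : seq T) :
  sat (suffix_run rho i) (foldr (@WOr 2) phi [seq f x | x <- l]) <->
  sat (suffix_run rho i) phi \/
  exists2 x, x \in l & sat (suffix_run rho i) (f x).
Proof.
elim: l => [|x l IHl] /=; first by split=> [|[|[]]] //; left.
rewrite IHl; split=> [[?|[?|[y yl ?]]]|[?|[y + ?]]].
- by right; exists x; rewrite // mem_head.
- by left.
- by right; exists y; rewrite // in_cons yl orbT.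
- by right; left.
- by rewrite in_cons => /orP[/eqP <-|yl]; [left|right; right; exists y].
Qed.

Lemma sat_bad : ~ sat rho bad_formula <->
  forall t s i w, (s, i, w) \in constraints (c t) ->
    ((t * K + s).*2.+1 <= N)%N ->
    sat (suffix_run rho (t * K + s).*2.+1) (target_formula (s, i, w)).
Proof.
rewrite -{1}(suffix_run0 rho) /bad_formula.
set body := foldr _ _ _.
have bodyP b : (b <= N)%N -> sat (suffix_run rho b) body <->
    exists t s i w, [/\ (s, i, w) \in constraints (c t),
      b = (t * K + s).*2.+1 &
      ~ sat (suffix_run rho b) (target_formula (s, i, w))].
  move=> leb; rewrite sat_foldr_or; split=> [[/(_ (sat_wtrue b))//|]|].
    case=> -[c' [[s i] w]] /allpairsPdep[c1 [x [_ xc [-> E]]]].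
    rewrite -{x}E in xc; have [lts _] := constraints_bound xc.
    rewrite /violation => /not_orP[/contrapT /(sat_source _ leb lts)[ob Ec Es]].
    move=> nt; exists (b./2 %/ K)%N, s, i, w; split=> //.
      by rewrite Ec.
    by rewrite -Es -divn_eq -[LHS]odd_double_half ob.
  case=> t [s [i [w [xc Eb nt]]]]; right.
  exists (c t, (s, i, w)); first by apply/allpairsPdep; exists (c t), (s, i, w);
    rewrite mem_enum.
  have [lts _] := constraints_bound xc.
  move=> [|//] nsrc; apply: nsrc; apply/(sat_source _ leb lts).
  rewrite Eb half_double1 oddS odd_double divnMDl // divn_small // addn0.
  by rewrite modnMDl modn_small.
rewrite sat_until; split=> [nb t s i w xc les|H [b [/andP[_ leb] + _ _]]].
  apply: contrapT => nt; apply: nb; exists (t * K + s).*2.+1; split=> //.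
  - by apply/bodyP => //; exists t, s, i, w.
  - by move=> *; exact: sat_wtrue.
  - have [lts _] := constraints_bound xc.
    have [-> _] := event_costs lts les.
    rewrite /cost_at /run_cost /= take0 subr0.
    by rewrite !addr_ge0 //; case/andP: (event_time_bound les).
case/(bodyP _ leb) => t [s [i [w [xc Eb]]]]; apply; rewrite Eb in leb *.
exact: H.
Qed.

(** Being main is constant along a cycle, so the first main position is the start of a cycle, and
    cycle t starts at time t K. *)
Lemma sat_load n : (0 < n)%N -> ~~ is_main M (start_cell M) ->
  sat rho (load_formula (n * K)) <->
  [/\ ((n * K).*2 <= N)%N, is_main M (c n) &
      forall t, (t < n)%N -> ~~ is_main M (c t)].
Proof.
clear m2 instr_bound; move=> n0 nstart; have [H _ c0 _] := prof.
have cost0 : cost_at ord0 rho 0 = 0 by rewrite /cost_at /run_cost /= take0.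
have costK t : ((t * K).*2 <= N)%N -> cost_at ord0 rho (t * K).*2 = (t * K)%:R.
  by case/H => _ -> _; rewrite doubleK odd_double addr0.
rewrite -{1}(suffix_run0 rho) sat_until.
split=> [[b [/andP[b0 leb] /(sat_main leb) mb nmain]]|[len mn nmain]].
  have [t Et Eb] : exists2 t, (b./2 %/ K)%N = t & b = (t * K).*2.
    exists (b./2 %/ K)%N => //; set t := (_ %/ _)%N.
    have let_ : ((t * K).*2 <= b)%N.
      by have := leq_divM b./2 K; rewrite -/t; have := odd_double_half b; lia.
    (* Otherwise the start of the cycle of [b] would be an earlier main position; it is not position
       0, since the starting cell is not main. *)
    apply/eqP; rewrite eqn_leq let_ andbT leqNgt; apply/negP => ltb.
    have := nmain (t * K).*2; rewrite ltb double_gt0 muln_gt0 /= andbT.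
    case E: (t) => [|t'] /=.
      by move: mb; rewrite -/t E c0 (negbTE nstart).
    move=> /(_ isT); apply; rewrite -E; apply/sat_main.
      exact: leq_trans leb.
    by rewrite doubleK mulnK.
  rewrite cost0 subr0 Eb costK -?Eb //= => /eqP; rewrite eqr_nat.
  rewrite eqn_pmul2r // => /eqP En; rewrite {}En in Et Eb.
  rewrite -Eb -Et; split=> // t' ltt'.
  case: t' ltt' => [|t'] ltt'; first by rewrite c0.
  have lt' : ((t'.+1 * K).*2 < b)%N by rewrite Eb ltn_double ltn_pmul2r -?Et.
  apply/negP => mt'; have := nmain (t'.+1 * K).*2.
  rewrite lt' double_gt0 muln_gt0 => /(_ isT); apply.
  by apply/(sat_main (ltnW (leq_trans lt' leb))); rewrite doubleK mulnK.
exists (n * K).*2; split.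
- by rewrite double_gt0 muln_gt0 n0 len.
- by apply/(sat_main len); rewrite doubleK mulnK.
- move=> b /andP[_ ltb].
  have leb : (b <= N)%N by exact: leq_trans (ltnW ltb) len.
  move=> /(sat_main leb); apply/negP; apply: nmain.
  by rewrite ltn_divLR // ltn_half_double.
- by rewrite /= cost0 subr0 costK.
Qed.

End Run.
End Formula.

(** * Correctness of the simulation *)

(** A conjunction written with negations. Only [load_formula] mentions [n], so the code of
    [bad_formula] can be part of the input. *)
Definition red_formula (C : finType) (M : control C) (m n : nat) : wmtl 2 :=
  WNot (WOr (bad_formula M m) (WNot (load_formula n))).

Section Correctness.
Local Open Scope ring_scope.
Variables (R : realType) (C : finType) (M : control C) (m : nat).
Local Notation K := m.+1.
Hypothesis m2 : (2 <= m)%N.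
Hypothesis instr_bound : forall c t r u i,
  instr_of M c = Some (t, r, u, i) -> (r < m)%N && (u < m)%N.
Hypothesis start_not_main : ~~ is_main M (start_cell M).
Hypothesis start_unreachable : forall c, ~~ next_cell M c (start_cell M).
Hypothesis final_main : forall c, instr_of M c = None -> is_main M c.

Lemma sat_red_formula (rho : run R (red_pta M m)) n :
  sat rho (red_formula M m n) <->
  ~ sat rho (bad_formula M m) /\ sat rho (load_formula n).
Proof.
split=> [/not_orP[nb /contrapT]//|[nb ld] [//|]]; exact.
Qed.

Lemma red_sound (rho : run R (red_pta M m)) n : (0 < n)%N ->
  is_run rho -> start rho = init_state R (red_pta M m) ->
  sat rho (red_formula M m (n * K)) -> accepts M n.
Proof.
move=> n0 Hrun Hstart /sat_red_formula[nbad load].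
have prof := profile_exists Hrun Hstart.
move: (cell_at rho) (event_time rho) prof => c V prof.
have good := (sat_bad prof instr_bound).1 nbad.
have [len mn nmain] := (sat_load prof n0 start_not_main).1 load.
have [_ HV c0 HS] := prof.
set N := run_length rho in len HV HS good.
have len0 : ((0 * K + m).*2.+1 <= N)%N.
  by apply: leq_trans len; have := leq_pmull K n0; lia.
have d0 : 0 < V 0%N.
  have [|_] := HV 0%N; first by apply: leq_trans len0; lia.
  by rewrite div0n mod0n c0; apply.
(* Until a final cell is met, each cycle is complete and its constraints demand targets in the next
   one. Hence the run goes on, and slot r + 1 holds register r times the unit [V 0]. *)
have key t : (forall u, (u < t)%N -> instr_of M (c u) <> None) ->
    [/\ ((t * K + m).*2.+1 <= N)%N, V (t * K)%N = V 0%N,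
        forall r, (r < m)%N ->
          V (t * K + r.+1)%N = (trace M c (fun=> 0%N) t r)%:R * V 0%N &
        forall u, (u < t)%N -> exists2 a, instr_of M (c u) = Some a &
          enabled a (trace M c (fun=> 0%N) u)].
  elim: t => [|t IHt] Hu.
    split=> // r ltr; rewrite mul0r mul0n add0n.
    have [|_] := HV r.+1; first by apply: leq_trans len0; lia.
    by rewrite divn_small // modn_small //= c0 => /(_ erefl) /eqP.
  have [lt Et Er Eu] := IHt (fun u ltu => Hu u (ltnW ltu)).
  have Ht : instr_of M (c t) <> None by exact: Hu.
  case Ea : (instr_of M (c t)) Ht => [[[[tt r] u] i]|] // _.
  have /andP[ltr ltu] := instr_bound Ea.
  have next s j w : (s, j, w) \in constraints M m (c t) ->
      ((t.+1 * K + w).*2.+1 <= N)%N /\ V (t.+1 * K + w)%N =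
        V (t * K + s)%N + (if j then V (t.+1 * K)%N else 0).
    move=> mem; have [lts ltw] := constraints_bound instr_bound mem.
    have les : ((t * K + s).*2.+1 <= N)%N by apply: leq_trans lt; lia.
    by apply/(sat_target prof m2 _ lts ltw les); exact: good.
  have same q : (q < K)%N -> tt || (q != r.+1) ->
      ((t.+1 * K + q).*2.+1 <= N)%N /\ V (t.+1 * K + q)%N = V (t * K + q)%N.
    move=> ltq Hq; have [|-> ->] := next q false q; last by rewrite addr0.
    rewrite /constraints Ea in_cons map_f ?orbT // mem_filter Hq mem_iota.
    by rewrite add0n.
  have [lr EVr] : ((t.+1 * K + r.+1).*2.+1 <= N)%N /\ V (t.+1 * K + r.+1)%N =
        V (t * K + u.+1)%N + (if i then V (t.+1 * K)%N else 0).
    by apply: next; rewrite /constraints Ea mem_head.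
  have E0 : V (t.+1 * K)%N = V 0%N.
    by have [] := same 0%N; rewrite ?addn0 ?orbT // Et.
  have {}EVr : V (t.+1 * K + r.+1)%N =
      (trace M c (fun=> 0%N) t u + i)%:R * V 0%N.
    by rewrite EVr Er // E0 natrD mulrDl; case: (i); rewrite ?mul1r ?mul0r.
  split.
  (* The last slot of the next cycle is itself a target: of a copy, or of the assignment if it is
     slot r + 1. *)
  - have [Hm|] := boolP (tt || (m != r.+1)); first by have [] := same m.
    by rewrite negb_or negbK => /andP[_ /eqP {2}->].
  - exact: E0.
  - move=> q ltq; rewrite /= Ea /=.
    case: ifP => [/andP[_ /eqP ->]|/negbT] //; rewrite negb_and negbK => Hq.
    by have [_ ->] := same q.+1 ltq Hq; exact: Er.
  - move=> v; rewrite ltnS leq_eqVlt => /orP[/eqP ->|]; last exact: Eu.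
    exists (tt, r, u, i) => //=; apply/implyP => Ht; apply/eqP.
    (* For a test, slot r + 1 is the target of both a copy and the constraint from slot u + 1;
       dividing by the positive unit gives the tested equality. *)
    have [_] := same r.+1 ltr (introT orP (or_introl Ht)).
    rewrite EVr Er // => /(mulIf (lt0r_neq0 d0)) /eqP.
    by rewrite eqr_nat => /eqP.
(* Without a final cell, [key] would give more cycles than the finite run has positions. *)
have Hfinal : exists t, instr_of M (c t) == None.
  apply: contrapT => nex.
  have [|] := key N => [u _ E|]; first by apply: nex; exists u; rewrite E.
  by move=> le; move: le; lia.
have [T /eqP ET Tmin] := ex_minnP Hfinal.
have HT u : (u < T)%N -> instr_of M (c u) <> None.
  by move=> ltu E; have := Tmin u; rewrite E => /(_ erefl); rewrite leqNgt ltu.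
exists T, c; split=> //.
- split=> // t ltt.
    have [le _ _ _] := key T HT; apply: HS; apply: leq_trans le.
    have : (t.+1 * K <= T * K)%N by rewrite leq_mul2r ltt orbT.
    by lia.
  by have [_ _ _] := key T HT; apply.
- rewrite leqNgt; apply/negP => /nmain; by rewrite final_main.
Qed.

Lemma red_complete n : (0 < n)%N -> accepts M n ->
  exists rho : run R (red_pta M m),
    [/\ is_run rho, start rho = init_state R (red_pta M m) &
        sat rho (red_formula M m (n * K))].
Proof.
move=> n0 [T [c [c0 [cS cI cT] nT cn nmain]]].
pose s t := trace M c (fun=> 0%N) t.
pose B := (\max_(t < T.+1) \max_(r < m) s t r)%N.
have sB t r : (t <= T)%N -> (r < m)%N -> (s t r <= B)%N.
  move=> let_ ltr.
  apply: leq_trans (@leq_bigmax_cond _ xpredT (fun t : 'I_T.+1 =>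
    (\max_(r < m) s t r)%N) (Ordinal (let_ : (t < T.+1)%N)) isT).
  exact: (@leq_bigmax_cond _ xpredT (fun r : 'I_m => s t r) (Ordinal ltr) isT).
(* No register exceeds [B], so all its multiples by this unit stay below 1; B + 2 keeps the unit
   itself below 1 when B = 0. *)
pose d : R := B.+2%:R^-1.
have d0 : 0 < d by rewrite invr_gt0 ltr0n.
have d1 : d < 1 by rewrite invf_lt1 ?ltr0n // ltr1n.
pose V j : R := if (j %% K)%N is r.+1 then (s (j %/ K)%N r)%:R * d else d.
have jT j : (j <= T * K + m)%N -> (j %/ K <= T)%N.
  by move=> lej; rewrite -ltnS ltn_divLR // mulSn; lia.
have V01 j : (j <= T * K + m)%N -> 0 <= V j < 1.
  move=> lej; rewrite /V; have := ltn_pmod j (ltn0Sn m).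
  case: (j %% K)%N => [_|r ltr]; first by rewrite ltW.
  rewrite mulr_ge0 ?ler0n ?(ltW d0) //= /d ltr_pdivrMr ?ltr0n // mul1r ltr_nat.
  by rewrite !ltnS (leq_trans (sB _ _ (jT _ lej) ltr)).
(* The guards of the starting cell force registers to be 0, so it must occur in cycle 0 only. *)
have cstart t : (t <= T)%N -> c t = start_cell M -> t = 0%N.
  case: t => // t ltt E; have := cS t ltt.
  by rewrite E (negbTE (start_unreachable _)).
pose p j : C * 'I_K := (c (j %/ K)%N, inord (j %% K)).
pose st i : state R (red_pta M m) :=
  (enum_rank ((p i./2, odd i) : loc C m), [ffun=> if odd i then V i./2 else 0]).
pose del i := if odd i then 1 - V i./2 else V i./2.
pose e i : edge (nloc (red_pta M m)) 1 :=
  if odd i then slot_edge (p i./2, p i./2.+1) else event_edge M (p i./2).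
(* The run stops just after the last event of cycle [T], the cycle of the final cell. *)
pose N := (T * K + m).*2.+1.
have move_st i : (i < N)%N -> mixed_move (st i) (del i) (e i) (st i.+1).
  rewrite -(odd_double_half i) /st /del /e; move: (i./2) => j.
  case: (odd i); rewrite ?add1n ?add0n => lti.
    have ltj : (j < T * K + m)%N by move: lti; rewrite /N; lia.
    rewrite /= uphalf_double doubleK negbK odd_double /=.
    apply: mixed_move_slot; last first.
      by have /andP[-> /ltW ->] := V01 j (ltnW ltj).
    rewrite /slot_next /= !inordK ?ltn_pmod // ltn_modS // divnS // modnS //.
    case: ifP => [/negbTE ->|/negbFE dvd]; first by rewrite !eqxx.
    rewrite dvd eqxx andbT add1n; apply: cS.
    have : (j.+1 %/ K <= T)%N by apply: jT.
    by rewrite divnS // dvd add1n.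
  have lej : (j <= T * K + m)%N by move: lti; rewrite /N; lia.
  rewrite /= doubleK uphalf_double odd_double /=.
  have /andP[Vj0 Vj1] := V01 j lej.
  apply: mixed_move_event => //=; rewrite !ffunE; split=> //.
  case: eqP => // /(cstart _ (jT _ lej)) Ej.
  rewrite -val_eqE /= inordK ?ltn_pmod // /V Ej.
  by case: (j %% K)%N => [|r] /=; rewrite ?mul0r.
have [Hrun HN Hst] := is_run_mkseq move_st.
set rho := Run _ _ in Hrun HN Hst.
have Hinit : start rho = init_state R (red_pta M m).
  rewrite /rho /= /st /= /p ?div0n ?mod0n c0 /init_state /=.
  suff -> : inord 0 = ord0 :> 'I_K by [].
  by apply: val_inj; rewrite /= inordK.
exists rho; split=> //; apply/sat_red_formula.
have prof := profile_exists Hrun Hinit.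
have Ec t : (t <= T)%N -> cell_at rho t = c t.
  move=> let_; rewrite /cell_at Hst /st /= ?enum_rankK /= ?doubleK ?mulnK //.
  by have := leq_mul2r K t T; rewrite let_ orbT /N; lia.
have Ev j : (j <= T * K + m)%N -> event_time rho j = V j.
  move=> lej; rewrite /event_time Hst ?ltnS ?leq_double //.
  by rewrite /st /= ffunE odd_double uphalf_double.
have tT t q : ((t * K + q).*2.+1 <= N)%N -> (q < K)%N -> (t <= T)%N.
  move=> le ltq; have := jT (t * K + q)%N.
  by rewrite divnMDl // divn_small // addn0; apply; move: le; rewrite /N; lia.
have Vslot t q : (q < K)%N ->
    V (t * K + q)%N = if q is r.+1 then (s t r)%:R * d else d.
  move=> ltq.
  by rewrite /V modnMDl modn_small // divnMDl // divn_small // addn0.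
split.
- apply/(sat_bad prof instr_bound) => t q i w mem les.
  have [ltq ltw] := constraints_bound instr_bound mem.
  have leT : (t <= T)%N by apply: tT ltq; rewrite -HN.
  rewrite Ec // in mem; apply/(sat_target prof m2 _ ltq ltw les).
  (* A final cell has no constraints, so no target is demanded beyond the end of the run. *)
  have ltT : (t < T)%N.
    rewrite ltn_neqAle leT andbT; apply: contraTneq mem => ->.
    by rewrite /constraints cT.
  have leS : (t.+1 * K <= T * K)%N by rewrite leq_mul2r ltT orbT.
  split; first by rewrite HN /N; lia.
  rewrite !Ev; [|lia..].
  have -> : V (t.+1 * K)%N = d by have := Vslot t.+1 0%N; rewrite addn0; apply.
  rewrite !Vslot //.
  have [[[[tt r] u] j] Ea ena] := cI t ltT.
  have Es : s t.+1 = effect (tt, r, u, j) (s t) by rewrite /s /= Ea.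
  (* The first constraint holds by [ena] for a test and by the effect for an assignment; the others
     are copies of slots left unchanged. *)
  move: mem; rewrite /constraints Ea in_cons => /orP[/eqP[-> -> ->]|].
    have -> : s t.+1 r = (s t u + j)%N.
      by rewrite Es /= eqxx andbT; case: tt ena {Es Ea} => //= /eqP.
    by rewrite natrD mulrDl; case: (j); rewrite ?mul1r ?mul0r.
  move=> /mapP[q' + [-> -> ->]]; rewrite mem_filter => /andP[Hq _].
  rewrite addr0; case: q' Hq => // q' Hq; rewrite Es /= ifF //.
  by apply/negbTE; rewrite negb_and negbK.
- apply/(sat_load prof n0 start_not_main); split.
  + rewrite HN /N; have : (n * K <= T * K)%N by rewrite leq_mul2r nT orbT.
    by lia.
  + by rewrite Ec.
  + by move=> t ltt; rewrite Ec ?nmain // ltnW // (leq_trans ltt).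
Qed.

End Correctness.

(** * Diagonalisation *)

Definition input_code (x y k : nat) : nat := CodeSeq.code [:: x; y; k].

Lemma input_code_inj x y k x' y' k' :
  input_code x y k = input_code x' y' k' -> [/\ x = x', y = y' & k = k'].
Proof. by move/(can_inj CodeSeq.codeK) => [-> -> ->]. Qed.

(* The code of [(A, red_formula M m (n * k))] when x and y are the codes of A
   and of [bad_formula M m], and n is [input_code x y k]. *)
Definition instance_code (x y k : nat) : nat :=
  CodeSeq.code [:: x; CodeSeq.code [:: 1; CodeSeq.code [:: 2; y;
    CodeSeq.code [:: 1; CodeSeq.code [:: 3; enc_wmtl (WNot (WAtom 2 0)); 0; 2;
      input_code x y k * k; enc_wmtl (WAtom 2 0)]]]]].

Lemma representable_input_code k (x y z : k.-tuple nat -> nat) :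
  representable x -> representable y -> representable z ->
  representable (fun xs => input_code (x xs) (y xs) (z xs)).
Proof. by move=> Hx Hy Hz; exact: (@representable_code k [:: x; y; z]). Qed.

Lemma representable_instance_code k (x y z : k.-tuple nat -> nat) :
  representable x -> representable y -> representable z ->
  representable (fun xs => instance_code (x xs) (y xs) (z xs)).
Proof.
move=> Hx Hy Hz; have cst := @representable_const k.
have Hn := representable_input_code Hx Hy Hz.
have Hm := representable_comp2 representable_mul Hn Hz.
have H1 := @representable_code k [:: fun=> 3; fun=> enc_wmtl (WNot (WAtom 2 0));
  fun=> 0; fun=> 2; fun xs => input_code (x xs) (y xs) (z xs) * z xs;
  fun=> enc_wmtl (WAtom 2 0)].
have H2 := @representable_code k [:: fun=> 1; _] (conj (cst 1) (conj (H1 _) I)).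
have H3 := @representable_code k [:: fun=> 2; y; _]
  (conj (cst 2) (conj Hy (conj (H2 _) I))).
have H4 := @representable_code k [:: fun=> 1; _] (conj (cst 1) (conj (H3 _) I)).
have H5 := @representable_code k [:: x; _] (conj Hx (conj (H4 _) I)).
by apply: H5; do !split.
Qed.

(** Decoding is done by guessing: registers 2, 3 and 4 receive arbitrary numbers, whose code is
    computed and compared with [n] in register 1. Only encodings need to be representable. Then [f]
    is run on the resulting instance and its value compared with 0. *)
Lemma diagonal_program (f : recfun 1) : exists P : prog, forall n,
  (exists s', exec P (loaded n) s') <->
  exists x y k, input_code x y k = n /\
    computes f [tuple instance_code x y k] 0.
Proof.
pose i0 : 'I_3 := inord 0; pose i1 : 'I_3 := inord 1; pose i2 : 'I_3 := inord 2.
have proj := @representable_proj 3.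
have [N HN] := representable_input_code (proj i0) (proj i1) (proj i2).
have [G HG] := representable_instance_code (proj i0) (proj i1) (proj i2).
pose F : recfun 3 := RComp f (fun=> G).
exists (PSeq (PStar (incr 2)) (PSeq (PStar (incr 3)) (PSeq (PStar (incr 4))
  (PSeq (compile N [:: 2; 3; 4] 5) (PSeq (test 5 1)
  (PSeq (compile F [:: 2; 3; 4] 5) (test 5 0))))))) => n.
have tE (x y z : nat) : [/\ tnth [tuple x; y; z] i0 = x,
    tnth [tuple x; y; z] i1 = y & tnth [tuple x; y; z] i2 = z].
  by split; rewrite (tnth_nth 0) /= inordK.
have FE x y z v : computes F [tuple x; y; z] v <->
    computes f [tuple instance_code x y z] v.
  have [E0 E1 E2] := tE x y z.
  split=> [[ys /(_ ord0) Hys]|Hf].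
    suff -> : [tuple instance_code x y z] = ys by [].
    apply: eq_from_tnth => i; rewrite !ord1.
    by apply: computes_fun Hys; have := HG [tuple x; y; z]; rewrite E0 E1 E2.
  exists [tuple instance_code x y z] => // i; rewrite !ord1.
  by have := HG [tuple x; y; z]; rewrite E0 E1 E2.
have NE x y z v : computes N [tuple x; y; z] v <-> v = input_code x y z.
  have [E0 E1 E2] := tE x y z; have := HN [tuple x; y; z]; rewrite E0 E1 E2.
  by move=> H; split=> [/computes_fun/(_ H)|->].
have spec (g : recfun 3) s : s 0 = 0 -> _ :=
  fun s0 => @compileP 3 g [:: 2; 3; 4] 5 s [tuple s 2; s 3; s 4]
    isT isT s0 erefl.
split=> [[s'] [_ /exec_incr_star[x ->]]|[x [y [z [En Hf]]]]].
  case=> _ /exec_incr_star[y ->] [s1 /exec_incr_star[z Es1]].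
  have [s10 s11] : s1 0 = 0 /\ s1 1 = n by rewrite Es1.
  case=> s2 /(proj1 (spec N s1 s10))[/NE Cn A2] [s3 /exec_test[E3 ->]].
  have [s20 s21] : s2 0 = 0 /\ s2 1 = n by rewrite !A2.
  case=> s4 /(proj1 (spec F s2 s20))[Cf A4] /exec_test[E4 _].
  exists (s2 2), (s2 3), (s2 4); split; first by rewrite !A2 // -Cn E3.
  by apply/FE; move: Cf; rewrite E4 A4 // s20.
pose upd (s : store) r v : store := fun q => if q == r then s r + v else s q.
pose s1 := upd (upd (upd (loaded n) 2 x) 3 y) 4 z.
have [s2 E2 E25] : exists2 s2, exec (compile N [:: 2; 3; 4] 5) s1 s2 &
    s2 5 = n.
  by have [//|_] := spec N s1; apply; apply/NE.
have [_ A2] := proj1 (spec N s1 erefl) _ E2.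
have s20 : s2 0 = 0 by rewrite A2.
have [s3 E3 E35] : exists2 s3, exec (compile F [:: 2; 3; 4] 5) s2 s3 &
    s3 5 = 0.
  by have [_] := spec F s2 s20; apply; apply/FE; rewrite !A2.
have [_ A3] := proj1 (spec F s2 s20) _ E3.
exists s3; exists (upd (loaded n) 2 x); first by apply/exec_incr_star; exists x.
exists (upd (upd (loaded n) 2 x) 3 y); first by apply/exec_incr_star; exists y.
exists s1; first by apply/exec_incr_star; exists z.
exists s2 => //; exists s2; first by apply/exec_test; rewrite E25 A2.
by exists s3 => //; apply/exec_test; rewrite E35 A3.
Qed.

Theorem theorem3p18 (R : realType) :
  ~ decidable_problem (@enc_instance 1 2)
      (fun I : pta 1 2 * wmtl 2 => forall i : 'I_2, stopwatch I.1 i)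
      (fun I : pta 1 2 * wmtl 2 =>
         exists rho : run R I.1,
           [/\ is_run rho, start rho = init_state R I.1 & sat rho I.2]).
Proof.
move=> [f Hf].
have [P HP] := diagonal_program f.
have [m0 Pm0] := prog_bound_exists P.
(* The bound [m0] gives each register of [P] a slot, and 2 ensures the three slots per cycle used in
   [sat_target]. *)
pose m := maxn 2 m0; pose M := prog_control P.
have m2 : 2 <= m by exact: leq_maxl.
have Pm : prog_bound m P by apply: prog_bound_leq Pm0; exact: leq_maxr.
have bound c t r u i (E : instr_of M c = Some (t, r, u, i)) :=
  prog_control_bound m2 Pm E.
have unreach c : ~~ next_cell M c (start_cell M) by case: c => [[]|].
have final c : instr_of M c = None -> is_main M c by case: c => [[]|].
pose A := red_pta M m.
pose n := input_code (enc_pta A) (enc_wmtl (bad_formula M m)) m.+1.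
have n0 : 0 < n by rewrite /n /input_code code_consE muln_gt0 expn_gt0.
have [yes no] := Hf (A, red_formula M m (n * m.+1)) (@red_pta_stopwatch _ M m).
(* By computation: [n] is [input_code] of these same three numbers, so [instance_code] rebuilds the
   constant of the formula. *)
have code : enc_instance (A, red_formula M m (n * m.+1)) =
    instance_code (enc_pta A) (enc_wmtl (bad_formula M m)) m.+1 by [].
rewrite code in yes no.
set Q := (exists rho, _) in yes no.
have QE : Q <-> computes f
    [tuple instance_code (enc_pta A) (enc_wmtl (bad_formula M m)) m.+1] 0.
  split=> [[rho [Hrun Hstart Hsat]]|H].
    by have /accepts_exec/HP[x [y [k [/input_code_inj[-> -> ->]]]]] :=
      red_sound m2 bound isT final n0 Hrun Hstart Hsat.
  have [s' Hs'] : exists s', exec P (loaded n) s'.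
    apply/HP; exists (enc_pta A), (enc_wmtl (bad_formula M m)), m.+1.
    exact: (conj erefl H).
  by have := red_complete R m2 bound isT unreach n0 (exec_accepts n0 Hs').
(* If [Q] held, [f] would take both values 1 and 0 on the instance; as it fails, [f] answers 0
   there, which by [QE] makes [Q] true. *)
have nQ : ~ Q by move=> /[dup] /yes H1 /QE /(computes_fun H1).
exact: (nQ (QE.2 (no nQ))).
Qed.
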